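(* Let $\alpha \in \mathbb{R}$, $\alpha \neq 0$. Among all rectangles $\mathcal{R} \subset \mathbb{R}^2$, the scale invariant quantity $\lambda_1(\mathcal{R};\alpha/L)\,A$ is minimal for the square and only the square, where $A$ is the area of $\mathcal{R}$ and $L$ is the length of $\partial\mathcal{R}$.
   Context: Rectangles are (up to rotation) products of two bounded nonempty open intervals. For a bounded Lipschitz domain $\Omega \subset \mathbb{R}^2$ and Robin parameter $\beta \in \mathbb{R}$, $\lambda_1(\Omega;\beta)$ denotes the first eigenvalue of the Robin problem $-\Delta u = \lambda u$ in $\Omega$, $\partial u/\partial \nu + \beta u = 0$ on $\partial \Omega$ ($\nu$ the outward unit normal). Equivalently $$\lambda_1(\Omega;\beta) = \min_{u \in H^1(\Omega)\setminus\{0\}} \frac{\int_\Omega |\nabla u|^2\,dx + \beta \int_{\partial\Omega} u^2\,dS}{\int_\Omega u^2\,dx}.$$ *)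

(* Defs.v *)
From HB Require Import structures.
From mathcomp Require Import all_boot all_order all_algebra.
From mathcomp Require Import all_classical all_reals all_analysis.

Set Implicit Arguments.
Unset Strict Implicit.
Unset Printing Implicit Defensive.

Import Order.TTheory GRing.Theory Num.Theory.
Import numFieldNormedType.Exports.

Local Open Scope classical_set_scope.
Local Open Scope ring_scope.

(* A function on a subset of the plane is represented by a total function on
   [R * R], of which only the values on that subset are ever used. *)

Section sobolev.
Context {R : realType}.

Definition leb1 := (@lebesgue_measure R).
Definition leb2 := (leb1 \x leb1)%E.

Definition L2 d (T : measurableType d) (mu : {measure set T -> \bar R})
    (D : set T) (f : T -> R) : Prop :=
  measurable_fun D f /\ ((\int[mu]_(x in D) ((f x) ^+ 2)%:E) < +oo)%E.

Definition dx (f : R * R -> R) (z : R * R) : R := 'D_((1, 0) : R * R) f z.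
Definition dy (f : R * R -> R) (z : R * R) : R := 'D_((0, 1) : R * R) f z.

Fixpoint Ck (k : nat) (f : R * R -> R) : Prop :=
  if k is k'.+1 then
    [/\ forall z, differentiable f z, Ck k' (dx f) & Ck k' (dy f)]
  else continuous f.

Definition test_function (Om : set (R * R)) (phi : R * R -> R) : Prop :=
  (forall k, Ck k phi) /\
  exists K : set (R * R),
    [/\ compact K, K `<=` Om & forall z, ~ K z -> phi z = 0].

Definition weak_gradient (Om : set (R * R)) (u : R * R -> R)
    (g : R * R -> R * R) : Prop :=
  forall phi, test_function Om phi ->
    (\int[leb2]_(z in Om) (u z * dx phi z)) =
      - (\int[leb2]_(z in Om) ((g z).1 * phi z)) /\
    (\int[leb2]_(z in Om) (u z * dy phi z)) =
      - (\int[leb2]_(z in Om) ((g z).2 * phi z)).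

(* [u] belongs to H^1(Om) and [g] represents its gradient. *)
Definition H1 (Om : set (R * R)) (u : R * R -> R) (g : R * R -> R * R) : Prop :=
  [/\ L2 leb2 Om u, L2 leb2 Om (fst \o g), L2 leb2 Om (snd \o g) &
      weak_gradient Om u g].

End sobolev.

Section rectangles.
Context {R : realType}.

(* The image of ]xmin, xmax[ x ]ymin, ymax[ under the rotation of the plane
   by [angle] about the origin. *)
Record rectangle := Rectangle {
  angle : R;
  xmin : R; xmax : R;
  ymin : R; ymax : R;
  xmin_lt_xmax : xmin < xmax;
  ymin_lt_ymax : ymin < ymax }.

Definition rotation (theta : R) (z : R * R) : R * R :=
  (cos theta * z.1 - sin theta * z.2, sin theta * z.1 + cos theta * z.2).

Definition region (r : rectangle) : set (R * R) :=
  rotation (angle r) @` (`]xmin r, xmax r[ `*` `]ymin r, ymax r[).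

(* Arc-length parametrizations of the four open sides: [i.1] says whether the
   side is parametrized by the first or the second unrotated coordinate, and
   [i.2] selects one of the two opposite sides. *)
Definition side_dom (r : rectangle) (i : bool * bool) : set R :=
  if i.1 then [set` `]xmin r, xmax r[] else [set` `]ymin r, ymax r[].

Definition side (r : rectangle) (i : bool * bool) (x : R) : R * R :=
  rotation (angle r)
    (if i.1 then (x, if i.2 then ymax r else ymin r)
     else (if i.2 then xmax r else xmin r, x)).

Definition boundary_int (r : rectangle) (f : R * R -> R) : R :=
  \sum_i \int[leb1]_(x in side_dom r i) f (side r i x).

Definition eboundary_int (r : rectangle) (f : R * R -> \bar R) : \bar R :=
  (\sum_i \int[leb1]_(x in side_dom r i) f (side r i x))%E.

Definition boundary_L2 (r : rectangle) (f : R * R -> R) : Prop :=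
  forall i, L2 leb1 (side_dom r i) (f \o side r i).

Definition is_square (r : rectangle) : Prop :=
  xmax r - xmin r = ymax r - ymin r.

Definition area (r : rectangle) : R := fine (leb2 (region r)).

Definition perimeter (r : rectangle) : R := boundary_int r (cst 1).

(* [t] is the boundary trace of a function [u] in H^1 with gradient [g].  The
   trace operator is the bounded extension of the restriction of C^1 functions
   to the boundary; C^1 functions on the plane are dense in H^1(region r). *)
Definition is_trace (r : rectangle) (u : R * R -> R) (g : R * R -> R * R)
    (t : R * R -> R) : Prop :=
  boundary_L2 r t /\
  exists w : nat -> R * R -> R,
    [/\ forall n, Ck 1 (w n),
        (\int[leb2]_(z in region r) ((w n z - u z) ^+ 2)%:E)%E
          @[n --> \oo] --> 0%E,
        (\int[leb2]_(z in region r)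
           ((dx (w n) z - (g z).1) ^+ 2 + (dy (w n) z - (g z).2) ^+ 2)%:E)%E
          @[n --> \oo] --> 0%E &
        eboundary_int r (fun z => ((w n z - t z) ^+ 2)%:E)
          @[n --> \oo] --> 0%E].

Definition H1_with_trace (r : rectangle) (u : R * R -> R)
    (g : R * R -> R * R) (t : R * R -> R) : Prop :=
  H1 (region r) u g /\ is_trace r u g t.

(* [lam] is an eigenvalue of the Robin problem with parameter [beta], in the
   usual weak sense: a nonzero [u] in H^1 satisfies
     int grad u . grad v + beta int_boundary u v = lam int u v
   for all [v] in H^1. *)
Definition robin_eigenvalue (r : rectangle) (beta lam : R) : Prop :=
  exists u g t,
    [/\ H1_with_trace r u g t,
        ~ {ae leb2, forall z, region r z -> u z = 0} &
        forall v h s, H1_with_trace r v h s ->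
          (\int[leb2]_(z in region r) ((g z).1 * (h z).1 + (g z).2 * (h z).2))
            + beta * boundary_int r (fun z => t z * s z)
          = lam * (\int[leb2]_(z in region r) (u z * v z))].

(* The least eigenvalue ([0] is a junk value, should there be none). *)
Definition robin_lambda1 (r : rectangle) (beta : R) : R :=
  xget 0 [set lam | robin_eigenvalue r beta lam /\
                    lbound (robin_eigenvalue r beta) lam].

End rectangles.

Arguments rectangle R : clear implicits.

(* Main.v *)
From HB Require Import structures.
Require Import Defs.
From mathcomp Require Import all_boot all_order all_algebra.
From mathcomp Require Import all_classical all_reals all_analysis.
From mathcomp Require Import measurable_realfun ring lra.

Set Implicit Arguments.
Unset Strict Implicit.
Unset Printing Implicit Defensive.

Import Order.TTheory GRing.Theory Num.Theory.
Import numFieldNormedType.Exports.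

Local Open Scope classical_set_scope.
Local Open Scope ring_scope.

(** The rectangle of sides [A] and [B] separates variables. If [p] and [q] are
    positive solutions of [- p'' = mu p] and [- q'' = nu q] satisfying the Robin
    condition at the ends of the two sides, then [p (x) q (y)] is an eigenfunction
    for [mu + nu], and no eigenvalue lies below: by Picone's inequality
    [\int v'^2 + beta (v^2 at the ends) >= mu \int v^2] on every line, hence the
    Rayleigh quotient of any function is at least [mu + nu]
    ([robin_lambda1E]). Traces being defined through [C^1] approximations, both
    facts are proved for [C^1] functions, where Fubini's theorem and the
    fundamental theorem of calculus apply, and then extended by continuity in
    [L^2]. The rotation of the rectangle is removed by a change of variables:
    planar Lebesgue measure is rotation invariant because rotations are products
    of shears ([leb2_rotation]).

    Let [kappa] be the sign of [alpha]. The modes are [c (k t)], where [c] is the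
    cosine or the hyperbolic cosine according to [kappa], and [s] is the
    corresponding sine. Writing [x = k A / 2] and [y] for the two phases at the ends
    of the sides, the Robin condition reads [load x = |alpha| A / (4 (A + B))] with
    [load x = x s x / c x], and similarly for [y], so the sum of the two loads is
    [|alpha| / 4] for every rectangle. With [level x = x^2 / load x] the scale
    invariant quantity becomes
    [4 kappa (load y * level x + load x * level y)] ([robin_lambda1_area]).

    It remains to see that this is smallest when both loads equal their mean [W]
    ([level_mean_gt]). The function [kappa * level] is strictly decreasing and
    convex as a function of the cube of the load ([slope_decreasing],
    [level_tangent]), that is, it is bounded below by [a - b * load^3] with
    equality at [W] and [b > 0]. For loads [X] and [Y] of mean [W] the sum is then
    at least [2 W (a - b W^3) + b (2 W^4 - X Y (X^2 + Y^2))], where the last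
    bracket is [(X - Y)^4 / 8], positive unless the rectangle is a square. The
    power three is what makes one argument serve both signs of [alpha]: for
    negative [alpha], [kappa * level] is not convex in the load itself. *)

(** * Rotation invariance of planar Lebesgue measure *)

Section shears.
Context {R : realType}.
Implicit Types (c : R) (A : set (R * R)) (z : R * R).

Lemma measurable_preimage d1 d2 (T1 : measurableType d1) (T2 : measurableType d2)
    (f : T1 -> T2) (A : set T2) :
  measurable_fun setT f -> measurable A -> measurable (f @^-1` A).
Proof. by move=> mf mA; rewrite -[X in measurable X]setTI; exact: mf. Qed.

(** Lebesgue measure is determined by its values on the intervals [`]a, b]]. *)
Lemma leb1_translation c (B : set (measurableTypeR R)) :
  measurable B -> leb1 ((fun x => x + c) @^-1` B) = leb1 B.
Proof.
move=> mB.
have mf : measurable_fun [set: measurableTypeR R] ((fun x => x + c) : measurableTypeR R -> measurableTypeR R).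
  exact: measurable_funD.
apply/esym.
pose m := measure_function_pushforward__canonical__measure_function_Measure (@lebesgue_measure R) mf.
rewrite -[RHS]/(m B).
apply: lebesgue_measure_unique => // _ [[a b] _ <-] /=.
rewrite /pushforward.
rewrite (_ : _ @^-1` _ = `]a - c, b - c]%classic); last first.
  by apply/seteqP; split=> x /=; rewrite !in_itv/= ltrBlDr lerBrDr.
by rewrite !lebesgue_measure_itv/= !lte_fin ltrD2r; case: ifP => // _; rewrite -!EFinB; congr (_%:E); ring.
Qed.

(** Naming the product makes unification choose the Borel structure on each
    factor, the one on which [leb2] is defined. *)
Definition plane := (measurableTypeR R * measurableTypeR R)%type.

Definition lin (a b c d : R) (z : plane) : plane :=
  (a * z.1 + b * z.2, c * z.1 + d * z.2).

Lemma measurable_lin a b c d : measurable_fun setT (lin a b c d).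
Proof.
apply: measurable_fun_pair; apply: measurable_funD; apply: measurable_funM => //;
  exact: measurable_fst || exact: measurable_snd.
Qed.

(** Vertical sections of the preimage are translates of those of [A]. *)
Lemma leb2_shear_y c (A : set plane) :
  measurable A -> leb2 (lin 1 0 c 1 @^-1` A) = leb2 A.
Proof.
move=> mA; apply: eq_integral => x _ /=.
rewrite -(leb1_translation (c * x) (measurable_xsection x mA)).
congr (leb1 _); apply/seteqP; split=> y /=; rewrite /xsection /= !inE /lin /=;
  by rewrite !mul1r mul0r addr0 addrC.
Qed.

Lemma leb2E (A : set plane) :
  measurable A -> leb2 A = (\int[leb1]_y leb1 (ysection A y))%E.
Proof.
move=> mA; rewrite -[RHS]/((leb1 \x^ leb1)%E A).
by apply: product_measure_unique => // B C mB mC/=; rewrite product_measure2E.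
Qed.

Lemma leb2_shear_x c (A : set plane) :
  measurable A -> leb2 (lin 1 c 0 1 @^-1` A) = leb2 A.
Proof.
move=> mA; rewrite !leb2E//; last exact: measurable_preimage (measurable_lin _ _ _ _) _.
apply: eq_integral => y _ /=.
rewrite -(leb1_translation (c * y) (measurable_ysection y mA)).
congr (leb1 _); apply/seteqP; split=> x /=; rewrite /ysection /= !inE /lin /=;
  by rewrite !mul1r mul0r add0r.
Qed.

Lemma rotationE t : rotation t = lin (cos t) (- sin t) (sin t) (cos t).
Proof. by apply/funext => z; rewrite /rotation /lin mulNr. Qed.

(** The outer shears are forced by the entries of the rotation matrix; their
    slope [tan (t / 2)] is infinite when [t] is an odd multiple of [pi]. *)
Lemma rotation_shears t : cos (t / 2) != 0 ->
  rotation t =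
    lin 1 (- tan (t / 2)) 0 1 \o lin 1 0 (sin t) 1 \o lin 1 (- tan (t / 2)) 0 1.
Proof.
move=> ct; rewrite rotationE; apply/funext => -[x y].
have st : sin t = 2 * sin (t / 2) * cos (t / 2).
  by rewrite [in LHS](splitr t) sinD; ring.
have ctt : cos t = cos (t / 2) ^+ 2 - sin (t / 2) ^+ 2.
  by rewrite [in LHS](splitr t) cosD; ring.
have := cos2Dsin2 (t / 2).
rewrite /lin /= /tan st ctt.
move: (cos (t / 2)) (sin (t / 2)) ct => C S C0 CS.
have E1 : 1 - S / C * (2 * S * C) = C ^+ 2 - S ^+ 2.
  rewrite (_ : S / C * _ = 2 * S ^+ 2); last by field.
  lra.
congr pair; last first.
  transitivity (2 * S * C * x + (1 - S / C * (2 * S * C)) * y); last by field.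
  by rewrite E1.
transitivity ((1 - S / C * (2 * S * C)) * x - S / C * (1 + (1 - S / C * (2 * S * C))) * y); last by field.
rewrite E1.
have -> : S / C * (1 + (C ^+ 2 - S ^+ 2)) = 2 * S * C.
  rewrite (_ : 1 + _ = 2 * C ^+ 2); last lra.
  by field.
by rewrite mulNr.
Qed.

Let invariant (f : plane -> plane) :=
  measurable_fun setT f /\ forall A, measurable A -> leb2 (f @^-1` A) = leb2 A.

Let invariant_comp f g : invariant f -> invariant g -> invariant (f \o g).
Proof.
move=> [mf hf] [mg hg]; split; first exact: measurableT_comp.
by move=> A mA; rewrite comp_preimage hg ?hf//; exact: measurable_preimage.
Qed.

Let invariant_rotation t : cos (t / 2) != 0 -> invariant (rotation t).
Proof.
move=> ct; rewrite rotation_shears//.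
have hx c : invariant (lin 1 c 0 1).
  by split; [exact: measurable_lin|exact: leb2_shear_x].
have hy c : invariant (lin 1 0 c 1).
  by split; [exact: measurable_lin|exact: leb2_shear_y].
by do 2?apply: invariant_comp.
Qed.

Lemma rotationD s t : rotation (s + t) = rotation s \o rotation t :> (_ -> R * R).
Proof.
by apply/funext => z; rewrite /rotation /= cosD sinD; congr pair; ring.
Qed.

Lemma measurable_rotation t : measurable_fun setT (rotation t : plane -> plane).
Proof. by rewrite rotationE; exact: measurable_lin. Qed.

(** Odd multiples of [pi], where the factorization into shears breaks down, are
    reached in two steps of which one is a quarter turn. *)
Lemma leb2_rotation t (A : set plane) :
  measurable A -> leb2 (rotation t @^-1` A) = leb2 A.
Proof.
move: A; suff [//] : invariant (rotation t).
have [ct|/invariant_rotation//] := eqVneq (cos (t / 2)) 0.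
have c4 : cos (pi / 2 / 2) != 0 :> R.
  apply: lt0r_neq0; apply: cos_gt0_pihalf; have := pi_gt0 R; lra.
rewrite -(subrK (pi / 2) t) rotationD.
apply: invariant_comp; last exact: invariant_rotation.
apply: invariant_rotation.
rewrite mulrBl cosB ct mul0r add0r mulf_neq0//.
  by apply/eqP => st; have := cos2Dsin2 (t / 2); rewrite ct st; lra.
apply: lt0r_neq0; apply: sin_gt0_pi; have := pi_gt0 R; lra.
Qed.

End shears.

(** * Square integrable functions *)

Section plane_topology.
Context {R : realType}.
Local Notation plane := (@plane R).

(** Rational open boxes form a countable basis of the plane. *)
Lemma open_measurable_plane (U : set (R * R)) : open U -> measurable (U : set plane).
Proof.
move=> oU.
pose box (q : rat * rat * (rat * rat)) : set plane :=
  `]ratr q.1.1, ratr q.1.2[ `*` `]ratr q.2.1, ratr q.2.2[.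
have -> : U = \bigcup_q (if `[< box q `<=` U >] then box q else set0).
  apply/seteqP; split=> [[x y] Uxy|z [q _]]; last by case: asboolP => // /[apply].
  have /nbhs_ballP[e /= e0 eU] := open_nbhs_nbhs (conj oU Uxy).
  have /rat_in_itvoo[a] : x - e < x by lra.
  have /rat_in_itvoo[b] : x < x + e by lra.
  have /rat_in_itvoo[c] : y - e < y by lra.
  have /rat_in_itvoo[d] : y < y + e by lra.
  rewrite !in_itv/= => /andP[d1 d2] /andP[c1 c2] /andP[b1 b2] /andP[a1 a2].
  exists ((a, b), (c, d)) => //; case: asboolP => [_|].
    by rewrite /box/= !in_itv/= a2 b1 c2 d1.
  case=> -[x' y'] /=; rewrite /box/= !in_itv/= => -[/andP[x1 x2] /andP[y1 y2]].
  by apply: eU; split; rewrite -ball_normE/= ltr_norml; apply/andP; split; lra.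
apply: countable_bigcupT_measurable => // q; case: asboolP => // _.
by apply: measurableX; exact: measurable_itv.
Qed.

Lemma continuous_measurable_plane (f : R * R -> R) :
  continuous f -> measurable_fun [set: plane] f.
Proof.
move=> /continuousP cf; apply: (measurability _ (RGenOpens.measurableE R)).
move=> _ [_ [a [b ->] <-]]; rewrite setTI; apply: open_measurable_plane.
exact/cf/interval_open.
Qed.

End plane_topology.

Section square_integrable.
Context d (T : measurableType d) (R : realType) (mu : {measure set T -> \bar R}).
Variables (D : set T) (mD : measurable D).
Implicit Types f g u : T -> R.

Lemma L2_sqr_integrable f :
  L2 mu D f -> mu.-integrable D (EFin \o (fun x => f x ^+ 2)).
Proof.
move=> [mf foo]; apply/integrableP; split.
  by apply/measurable_EFinP; exact: measurable_funX.
apply: le_lt_trans foo; apply: ge0_le_integral => //=.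
- do 2 apply: measurableT_comp => //; exact: measurable_funX.
- by apply/measurable_EFinP; exact: measurable_funX.
- by move=> x _; rewrite lee_fin ger0_norm// sqr_ge0.
Qed.

Lemma L2_integrable_mul f g :
  L2 mu D f -> L2 mu D g -> mu.-integrable D (EFin \o (fun x => f x * g x)).
Proof.
move=> Lf Lg; have [mf _] := Lf; have [mg _] := Lg.
apply: (@le_integrable _ _ _ _ _ _ _ (EFin \o (fun x => f x ^+ 2 + g x ^+ 2))) => //.
- by apply/measurable_EFinP; exact: measurable_funM.
- move=> x _ /=; rewrite lee_fin [leRHS]ger0_norm ?addr_ge0 ?sqr_ge0//.
  rewrite ler_norml; apply/andP; split.
    by have := sqr_ge0 (f x + g x); have := sqr_ge0 (f x); have := sqr_ge0 (g x); nra.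
  by have := sqr_ge0 (f x - g x); have := sqr_ge0 (f x); have := sqr_ge0 (g x); nra.
- by rewrite (_ : _ \o _ = (EFin \o (fun x => f x ^+ 2)) \+ (EFin \o (fun x => g x ^+ 2)))//;
    apply: integrableD => //; exact: L2_sqr_integrable.
Qed.

Lemma L2D f g : L2 mu D f -> L2 mu D g -> L2 mu D (f \+ g).
Proof.
move=> Lf Lg; have [mf _] := Lf; have [mg _] := Lg; split; first exact: measurable_funD.
have /integrableP[_] : mu.-integrable D (EFin \o (fun x => (f x ^+ 2 + g x ^+ 2) *+ 2)).
  under [X in mu.-integrable D X]eq_fun do rewrite /= mulr2n EFinD.
  by apply: integrableD => //;
    (under [X in mu.-integrable D X]eq_fun do rewrite EFinD);
    apply: integrableD => //; exact: L2_sqr_integrable.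
apply: le_lt_trans; apply: ge0_le_integral => //=.
- by move=> x _; rewrite lee_fin sqr_ge0.
- by apply/measurable_EFinP; apply: measurable_funX; exact: measurable_funD.
- do 2 apply: measurableT_comp => //.
  under eq_fun do rewrite mulr2n.
  by do 2?apply: measurable_funD; exact: measurable_funX.
- move=> x _; rewrite lee_fin ger0_norm ?mulrn_wge0 ?addr_ge0 ?sqr_ge0//.
  by have := sqr_ge0 (f x - g x); nra.
Qed.

Lemma L2Z k f : L2 mu D f -> L2 mu D (fun x => k * f x).
Proof.
move=> Lf; have [mf foo] := Lf; split; first exact: measurable_funM.
under eq_integral do rewrite exprMn EFinM.
rewrite integralZl//; last exact: L2_sqr_integrable.
by rewrite lte_mul_pinfty// lee_fin sqr_ge0.
Qed.

Lemma L2B f g : L2 mu D f -> L2 mu D g -> L2 mu D (f \- g).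
Proof.
move=> Lf /(L2Z (-1)) Lg; have := L2D Lf Lg.
by congr L2; apply/funext => x /=; rewrite mulN1r.
Qed.

(** The quadratic polynomial [t |-> \int (f + t g)^2] is nonnegative. *)
Lemma cauchy_schwarz f g : L2 mu D f -> L2 mu D g ->
  (\int[mu]_(x in D) (f x * g x)) ^+ 2 <=
    (\int[mu]_(x in D) (f x ^+ 2)) * (\int[mu]_(x in D) (g x ^+ 2)).
Proof.
move=> Lf Lg.
set I := \int[mu]_(x in D) (f x * g x); set F := \int[mu]_(x in D) _.
set G := \int[mu]_(x in D) _.
have pos t : 0 <= F + 2 * t * I + t ^+ 2 * G.
  have : 0 <= \int[mu]_(x in D) ((f x + t * g x) ^+ 2).
    by apply: Rintegral_ge0 => x _; exact: sqr_ge0.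
  rewrite (_ : \int[mu]_(x in D) _ = \int[mu]_(x in D) (f x ^+ 2 + (2 * t * (f x * g x) + t ^+ 2 * g x ^+ 2))); last first.
    by apply: eq_Rintegral => x _; ring.
  have i1 := L2_sqr_integrable Lf; have i2 := L2_sqr_integrable Lg.
  have i3 := L2_integrable_mul Lf Lg.
  have Z k h : mu.-integrable D (EFin \o h) -> mu.-integrable D (EFin \o (fun x => k * h x)).
    by move=> /(integrableZl mD k); apply: eq_integrable.
  have A h k : mu.-integrable D (EFin \o h) -> mu.-integrable D (EFin \o k) ->
      mu.-integrable D (EFin \o (fun x => h x + k x)).
    by move=> hi ki; exact: (integrableD mD hi ki).
  rewrite RintegralD//; last by apply: A; exact: Z.
  by rewrite RintegralD ?RintegralZl ?addrA//; exact: Z.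
have G0 : 0 <= G by apply: Rintegral_ge0 => x _; exact: sqr_ge0.
have F0 : 0 <= F by apply: Rintegral_ge0 => x _; exact: sqr_ge0.
have [GE|GN] := eqVneq G 0; last first.
  have Gp : 0 < G by rewrite lt_def GN.
  (* The minimizer of the quadratic polynomial. *)
  have := pos (- I / G); rewrite (_ : _ + _ = (F * G - I ^+ 2) / G); last by field.
  by rewrite pmulr_lge0 ?invr_gt0// subr_ge0.
have [->|IN] := eqVneq I 0; first by rewrite expr0n/= mulr_ge0.
(* Without quadratic term, a nonzero linear term would take the value [-1]. *)
have := pos (- (F + 1) / (2 * I)).
rewrite GE (_ : _ + _ = -1); last by field.
by move=> ?; exfalso; lra.
Qed.

(** With [L2_cvg_sqr], this carries identities and inequalities from the smooth
    functions that define a trace over to all of [H^1]. *)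
Lemma L2_cvg_mul (w : nat -> T -> R) u f :
  (forall n, L2 mu D (w n)) -> L2 mu D u -> L2 mu D f ->
  (\int[mu]_(x in D) ((w n x - u x) ^+ 2)%:E)%E @[n --> \oo] --> 0%E ->
  \int[mu]_(x in D) (f x * w n x) @[n --> \oo] --> \int[mu]_(x in D) (f x * u x).
Proof.
move=> Lw Lu Lf /fine_cvg wu; apply/subr_cvg0/norm_cvg0P.
have {wu} : Num.sqrt (\int[mu]_(x in D) (f x ^+ 2) * \int[mu]_(x in D) ((w n x - u x) ^+ 2))
    @[n --> \oo] --> 0.
  rewrite -[X in _ --> X](sqrtr0 R) -[X in Num.sqrt X](mulr0 (\int[mu]_(x in D) (f x ^+ 2))).
  by apply: continuous_cvg; [exact: sqrt_continuous|exact: cvgMl_tmp].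
apply: squeeze_cvgr; last exact: cvg_cst.
apply: nearW => n; rewrite normr_ge0 /= -RintegralB//; [|exact: L2_integrable_mul..].
rewrite -sqrtr_sqr ler_wsqrtr//.
under eq_Rintegral do rewrite -mulrBr.
by apply: cauchy_schwarz => //; exact: L2B.
Qed.

Lemma L2_cvg_sqr (w : nat -> T -> R) u :
  (forall n, L2 mu D (w n)) -> L2 mu D u ->
  (\int[mu]_(x in D) ((w n x - u x) ^+ 2)%:E)%E @[n --> \oo] --> 0%E ->
  \int[mu]_(x in D) (w n x ^+ 2) @[n --> \oo] --> \int[mu]_(x in D) (u x ^+ 2).
Proof.
move=> Lw Lu wu.
have uw := L2_cvg_mul Lw Lu Lu wu.
move/fine_cvg : wu => /= wu.
have -> : (fun n => \int[mu]_(x in D) (w n x ^+ 2)) =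
  (fun n => \int[mu]_(x in D) ((w n x - u x) ^+ 2) +
    (2 * \int[mu]_(x in D) (u x * w n x) - \int[mu]_(x in D) (u x ^+ 2))).
  apply/funext => n.
  have i1 := L2_sqr_integrable (L2B (Lw n) Lu); have i2 := L2_sqr_integrable Lu.
  have i3 : mu.-integrable D (EFin \o (fun x => 2 * (u x * w n x))).
    exact: (integrableZl mD 2 (L2_integrable_mul Lu (Lw n))).
  rewrite -RintegralZl//; last exact: L2_integrable_mul.
  rewrite -RintegralB// -RintegralD//; last exact: (integrableB mD i3 i2).
  by apply: eq_Rintegral => x _; ring.
rewrite [X in _ --> X](_ : _ = 0 + (2 * \int[mu]_(x in D) (u x * u x) - \int[mu]_(x in D) (u x ^+ 2))); last first.
  by under [in RHS]eq_Rintegral do rewrite -expr2; ring.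
apply: cvgD => //; by apply: cvgB; [exact: cvgMl_tmp|exact: cvg_cst].
Qed.

End square_integrable.

(** * Integration over rectangles *)

Section change_of_variables.
Context {R : realType}.
Local Notation plane := (@plane R).
Implicit Types (t : R) (r : rectangle R).

Definition box r : set plane := `]xmin r, xmax r[ `*` `]ymin r, ymax r[.

Lemma rotationK t : cancel (rotation t : plane -> plane) (rotation (- t)).
Proof.
move=> [x y]; rewrite /rotation /= cosN sinN; have := cos2Dsin2 t => E.
by congr pair; [transitivity ((cos t ^+ 2 + sin t ^+ 2) * x)|
  transitivity ((cos t ^+ 2 + sin t ^+ 2) * y)]; (ring || rewrite E mul1r).
Qed.

Lemma rotationVK t : cancel (rotation (- t)) (rotation t : plane -> plane).
Proof. by move=> z; rewrite -{1}(opprK t) rotationK. Qed.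

Lemma regionE r : region r = (rotation (- angle r) : plane -> plane) @^-1` box r.
Proof.
apply/seteqP; split=> [_ [z rz <-]|z rz] /=; first by rewrite rotationK.
by exists (rotation (- angle r) z) => //; rewrite rotationVK.
Qed.

Lemma preimage_region r : (rotation (angle r) : plane -> plane) @^-1` region r = box r.
Proof.
rewrite regionE -comp_preimage; apply/seteqP; split=> z /=; by rewrite rotationK.
Qed.

Lemma measurable_box r : measurable (box r).
Proof. by apply: measurableX; exact: measurable_itv. Qed.

Lemma measurable_region r : measurable (region r : set plane).
Proof.
rewrite regionE; apply: measurable_preimage (measurable_box r).
exact: measurable_rotation.
Qed.
#[local] Hint Resolve measurable_region measurable_box : core.

Lemma leb2_box r :
  leb2 (box r) = ((xmax r - xmin r) * (ymax r - ymin r))%:E.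
Proof.
rewrite [LHS]product_measure1E//=.
by rewrite !lebesgue_measure_itv/= !lte_fin !xmin_lt_xmax !ymin_lt_ymax -!EFinB.
Qed.

Lemma leb2_region r :
  leb2 (region r) = ((xmax r - xmin r) * (ymax r - ymin r))%:E.
Proof. by rewrite -(leb2_rotation (angle r))// preimage_region leb2_box. Qed.

(** Rotation invariance of the measure, as a change of variables, for the positive
    and the negative part separately. *)
Lemma integral_region r (f : plane -> \bar R) : measurable_fun (region r) f ->
  (\int[leb2]_(z in region r) f z = \int[leb2]_(z in box r) f (rotation (angle r) z))%E.
Proof.
move=> mf.
have ge0 (h : plane -> \bar R) : measurable_fun (region r) h -> (forall z, 0 <= h z)%E ->
    (\int[leb2]_(z in region r) h z = \int[leb2]_(z in box r) h (rotation (angle r) z))%E.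
  move=> mh h0; have mrot := measurable_rotation (angle r).
  have /= E := @ge0_integral_pushforward _ _ plane plane R _ mrot
    (@lebesgue_measure R \x @lebesgue_measure R)%E _ _ (measurable_region r) mh (fun z _ => h0 z).
  rewrite preimage_region in E; apply: etrans E.
  apply: eq_measure_integral => A mA _.
  exact/esym/leb2_rotation.
rewrite integralE [RHS]integralE; congr (_ - _)%E.
  rewrite ge0//; last exact: measurable_funepos.
  by apply: eq_integral => z _; rewrite !funeposE.
rewrite ge0//; last exact: measurable_funeneg.
by apply: eq_integral => z _; rewrite !funenegE.
Qed.

Lemma Rintegral_region r (f : plane -> R) : measurable_fun (region r) f ->
  \int[leb2]_(z in region r) f z = \int[leb2]_(z in box r) f (rotation (angle r) z).
Proof.
by move=> mf; congr fine; rewrite integral_region//; exact/measurable_EFinP.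
Qed.

End change_of_variables.

Section integrability_of_continuous_functions.
Context {R : realType}.
Local Notation plane := (@plane R).
Implicit Types (r : rectangle R).

Lemma L2_bounded d (T : measurableType d) (mu : {measure set T -> \bar R}) (D : set T)
    (f : T -> R) (M : R) :
  measurable D -> (mu D < +oo)%E -> measurable_fun D f ->
  (forall x, D x -> `|f x| <= M) -> L2 mu D f.
Proof.
move=> mD muD mf fM; split=> //.
apply: (@le_lt_trans _ _ (\int[mu]_(x in D) (cst (M ^+ 2)%:E) x)%E).
  apply: ge0_le_integral => //.
  - by move=> x _; rewrite lee_fin sqr_ge0.
  - by apply/measurable_EFinP; exact: measurable_funX.
  - by move=> x Dx; rewrite lee_fin -[f x ^+ 2]real_normK ?num_real// ler_pXn2r ?nnegrE ?fM// (le_trans _ (fM _ Dx)).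
by rewrite integral_cst//= lte_mul_pinfty// lee_fin sqr_ge0.
Qed.

Lemma continuous_compact_bounded (T : topologicalType) (K : set T) (f : T -> R) :
  continuous f -> compact K -> exists M, forall x, K x -> `|f x| <= M.
Proof.
move=> cf cK.
have /compact_bounded : compact (f @` K).
  by apply: continuous_compact => //; exact: continuous_subspaceT.
move=> [M [Mr HM]]; exists (M + 1) => x Kx.
by apply: (HM (M + 1)); [rewrite ltrDl|exists x].
Qed.

Lemma continuous_L2_box (f : R * R -> R) a b c d : continuous f ->
  L2 leb2 (`]a, b[ `*` `]c, d[ : set plane) f.
Proof.
move=> cf.
have cK : compact (`[a, b]%classic `*` `[c, d]%classic : set (R * R)).
  by apply: compact_setX; exact: segment_compact.
have [M HM] := continuous_compact_bounded cf cK.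
apply: (@L2_bounded _ _ _ _ _ M).
- by apply: measurableX; exact: measurable_itv.
- rewrite [ltLHS]product_measure1E//=.
  by rewrite !lebesgue_measure_itv/=; do 2 case: ifP => _; rewrite ?mule0 ?mul0e ?ltry.
- by apply: measurable_funTS; exact: continuous_measurable_plane.
- by move=> z [z1 z2]; apply: HM; split; exact: subset_itv_oo_cc.
Qed.

Lemma continuous_L2_itv (f : R -> R) a b : continuous f ->
  L2 leb1 (`]a, b[ : set (measurableTypeR R)) f.
Proof.
move=> cf.
have [M HM] := continuous_compact_bounded cf (@segment_compact R a b).
apply: (@L2_bounded _ _ _ _ _ M).
- exact: measurable_itv.
- by rewrite /= lebesgue_measure_itv/=; case: ifP => _; rewrite ?ltry.
- by apply: measurable_funTS; exact: continuous_measurable_fun.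
- by move=> z z1; apply: HM; exact: subset_itv_oo_cc.
Qed.

Lemma continuous_integrable_box (f : R * R -> R) a b c d : continuous f ->
  leb2.-integrable (`]a, b[ `*` `]c, d[ : set plane) (EFin \o f).
Proof.
move=> cf.
have mB : measurable (`]a, b[ `*` `]c, d[ : set plane) by apply: measurableX; exact: measurable_itv.
have L1 : L2 leb2 (`]a, b[ `*` `]c, d[ : set plane) (cst 1).
  by apply: continuous_L2_box => z; exact: cvg_cst.
have := L2_integrable_mul mB (continuous_L2_box a b c d cf) L1.
by apply: eq_integrable => // z _ /=; rewrite mulr1.
Qed.

Lemma continuous_integrable_itv (f : R -> R) a b : continuous f ->
  leb1.-integrable (`]a, b[ : set (measurableTypeR R)) (EFin \o f).
Proof.
move=> cf.
have L1 : L2 leb1 (`]a, b[ : set (measurableTypeR R)) (cst 1).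
  by apply: continuous_L2_itv => z; exact: cvg_cst.
have mI : measurable (`]a, b[%classic : set (measurableTypeR R)) by exact: measurable_itv.
have := L2_integrable_mul mI (continuous_L2_itv a b cf) L1.
by apply: eq_integrable => // z _ /=; rewrite mulr1.
Qed.

Lemma rotation_continuous t : continuous (rotation t : R * R -> R * R).
Proof.
move=> z.
have c1 : cos t * w.1 - sin t * w.2 @[w --> z] --> cos t * z.1 - sin t * z.2.
  by apply: cvgB; apply: cvgMl_tmp; [exact: cvg_fst|exact: cvg_snd].
have c2 : sin t * w.1 + cos t * w.2 @[w --> z] --> sin t * z.1 + cos t * z.2.
  by apply: cvgD; apply: cvgMl_tmp; [exact: cvg_fst|exact: cvg_snd].
exact: cvg_pair c1 c2.
Qed.

Lemma continuous_L2_region r (f : R * R -> R) : continuous f -> L2 leb2 (region r) f.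
Proof.
move=> cf.
have mf : measurable_fun (region r : set plane) f.
  by apply: measurable_funTS; exact: continuous_measurable_plane.
split=> //; rewrite integral_region; last first.
  by apply/measurable_EFinP; exact: measurable_funX.
have cfr : continuous (f \o rotation (angle r)).
  by move=> z; apply: continuous_comp; [exact: rotation_continuous|exact: cf].
by have [] := continuous_L2_box (xmin r) (xmax r) (ymin r) (ymax r) cfr.
Qed.

Lemma continuous_integrable_region r (f : R * R -> R) : continuous f ->
  leb2.-integrable (region r : set plane) (EFin \o f).
Proof.
move=> cf.
have L1 : L2 leb2 (region r) (cst 1).
  by apply: continuous_L2_region => z; exact: cvg_cst.
have := L2_integrable_mul (measurable_region r) (continuous_L2_region r cf) L1.
by apply: eq_integrable => [|z _ /=]; [exact: measurable_region|rewrite mulr1].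
Qed.

End integrability_of_continuous_functions.

Section box_fubini.
Context {R : realType}.
Local Notation plane := (@plane R).
Variables (f : R * R -> R) (cf : continuous f) (a b c d : R).
Let A : set (measurableTypeR R) := `]a, b[%classic.
Let B : set (measurableTypeR R) := `]c, d[%classic.

Lemma continuous_slice1 y : continuous (fun x => f (x, y)).
Proof.
move=> x; apply: (@continuous_comp _ _ _ (fun x => (x, y)) f); last exact: cf.
exact: cvg_pair cvg_id (cvg_cst y).
Qed.

Lemma continuous_slice2 x : continuous (fun y => f (x, y)).
Proof.
move=> y; apply: (@continuous_comp _ _ _ (fun y => (x, y)) f); last exact: cf.
exact: cvg_pair (cvg_cst x) cvg_id.
Qed.

Let intf : leb2.-integrable [set: plane] (EFin \o (f \_ (A `*` B))).
Proof.
rewrite -restrict_EFin; apply/integrable_restrict => //.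
  by apply: measurableX; exact: measurable_itv.
by rewrite setTI; exact: continuous_integrable_box.
Qed.

Let slice1E y : (\int[leb1]_x ((f \_ (A `*` B)) (x, y))%:E)%E =
  (((fun y => \int[leb1]_(x in A) f (x, y)) \_ B) y)%:E.
Proof.
rewrite patchE; case: ifPn => [/set_mem By|/negP By]; last first.
  rewrite integral0_eq// => x _; rewrite patchE ifN//.
  by apply/negP => /set_mem[_ /= yB]; apply: By; exact/mem_set.
rewrite /Rintegral fineK; last first.
  have := continuous_integrable_itv a b (@continuous_slice1 y).
  by move/(integrable_fin_num (mu := @lebesgue_measure R) (measurable_itv _)).
rewrite [RHS]integral_mkcond; apply: eq_integral => x _.
rewrite !patchE (_ : ((x, y) \in _) = (x \in A)); first by case: ifP.
by apply/idP/idP => /set_mem xA; apply/mem_set; [case: xA|split].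
Qed.

Let slice2E x : (\int[leb1]_y ((f \_ (A `*` B)) (x, y))%:E)%E =
  (((fun x => \int[leb1]_(y in B) f (x, y)) \_ A) x)%:E.
Proof.
rewrite patchE; case: ifPn => [/set_mem Ax|/negP Ax]; last first.
  rewrite integral0_eq// => y _; rewrite patchE ifN//.
  by apply/negP => /set_mem[/= xA _]; apply: Ax; exact/mem_set.
rewrite /Rintegral fineK; last first.
  have := continuous_integrable_itv c d (@continuous_slice2 x).
  by move/(integrable_fin_num (mu := @lebesgue_measure R) (measurable_itv _)).
rewrite [RHS]integral_mkcond; apply: eq_integral => y _.
rewrite !patchE (_ : ((x, y) \in _) = (y \in B)); first by case: ifP.
by apply/idP/idP => /set_mem yB; apply/mem_set; [case: yB|split].
Qed.

(** Fubini's theorem for the extension of [f] by zero outside the box. *)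
Lemma box_fubini1 : \int[leb2]_(z in A `*` B) f z =
  \int[leb1]_(y in B) \int[leb1]_(x in A) f (x, y).
Proof.
rewrite Rintegral_mkcond [RHS]Rintegral_mkcond; congr fine.
rewrite -(integral21_prod_meas1 intf); apply: eq_integral => y _.
exact: slice1E.
Qed.

Lemma box_fubini2 : \int[leb2]_(z in A `*` B) f z =
  \int[leb1]_(x in A) \int[leb1]_(y in B) f (x, y).
Proof.
rewrite Rintegral_mkcond [RHS]Rintegral_mkcond; congr fine.
rewrite -(integral12_prod_meas1 intf); apply: eq_integral => x _.
exact: slice2E.
Qed.

Let integrable_fubini_G : (@lebesgue_measure R).-integrable setT
  (fubini_G (@lebesgue_measure R) (EFin \o (f \_ (A `*` B)))).
Proof.
have mf := measurable_int _ intf.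
apply/integrableP; split; first exact: (measurable_fubini_G intf).
have /(integrable21ltyP (@lebesgue_measure R) (@lebesgue_measure R) mf) := intf; apply: le_lt_trans.
apply: ge0_le_integral => //.
- by apply: measurableT_comp => //; exact: (measurable_fubini_G intf).
- apply: (measurable_fun_fubini_tonelli_G (fun z => `|(EFin \o (f \_ (A `*` B))) z|%E)) => //.
  exact: measurableT_comp.
- move=> y _; apply: le_abse_integral => //.
  exact: measurable_fun_pair1.
Qed.

Lemma integrable_slice1 :
  leb1.-integrable B (EFin \o (fun y => \int[leb1]_(x in A) f (x, y))).
Proof.
rewrite -[B]setTI; apply/integrable_restrict => //; first exact: measurable_itv.
rewrite restrict_EFin; apply: eq_integrable integrable_fubini_G => // y _.
exact: slice1E.
Qed.

End box_fubini.

(** * One-dimensional Robin modes *)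

Section interval.
Context {R : realType}.
Implicit Types (a b x beta mu : R) (p dp v dv f F : R -> R).

Lemma is_derive_continuous (F f : R -> R) : (forall x, is_derive x 1 F (f x)) -> continuous F.
Proof.
move=> dF x; apply: differentiable_continuous; apply/derivable1_diffP.
by have [] := dF x.
Qed.

Lemma Rintegral_derive a b F f : a < b ->
  (forall x, x \in `[a, b] -> is_derive x 1 F (f x)) ->
  {within `[a, b], continuous f} ->
  \int[leb1]_(x in `]a, b[) f x = F b - F a.
Proof.
move=> ab dF cf.
have cF x : x \in `[a, b] -> {for x, continuous F}.
  move=> xab; apply: differentiable_continuous; apply/derivable1_diffP.
  by have [] := dF x xab.
have E := continuous_FTC2 ab cf.
have /E/(_ _)E1 : derivable_oo_LRcontinuous F a b.
  split.
  - by move=> x xab; have [] := dF x (subset_itv_oo_cc xab).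
  - by apply: cvg_at_right_filter; apply: cF; rewrite in_itv/= lexx ltW.
  - by apply: cvg_at_left_filter; apply: cF; rewrite in_itv/= lexx ltW.
have dFf : {in `]a, b[, F^`()%classic =1 f}.
  move=> x /subset_itv_oo_cc xab; rewrite derive1E.
  by have [_ ->] := dF x xab.
have icf : leb1.-integrable (`[a, b] : set (measurableTypeR R)) (EFin \o f).
  by apply: continuous_compact_integrable => //; exact: segment_compact.
rewrite -[RHS]/(fine ((F b)%:E - (F a)%:E)) -(E1 dFf).
rewrite -/(\int[leb1]_(x in `[a, b]) f x).
rewrite -Rintegral_itv_bndo_bndc; last first.
  by apply: integrableS icf => // x /=; rewrite !in_itv/= => /andP[-> /ltW ->].
rewrite -Rintegral_itv_obnd_cbnd//.
by apply: integrableS icf => //; exact: subset_itv_oo_cc.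
Qed.

(** A positive solution [p] of [- p'' = mu p] on [`[a, b]] satisfying the Robin
    condition at both ends, together with its derivative. *)
Definition robin_mode (beta mu a b : R) (p dp : R -> R) : Prop :=
  [/\ forall x, is_derive x 1 p (dp x),
      forall x, is_derive x 1 dp (- mu * p x),
      forall x, x \in `[a, b] -> 0 < p x,
      dp a = beta * p a & dp b = - beta * p b].

(** Integration by parts: the Robin condition on [p] turns the boundary term
    [p' v] into [- beta p v]. *)
Lemma robin_mode_weak beta mu a b p dp v dv : a < b -> robin_mode beta mu a b p dp ->
  (forall x, is_derive x 1 v (dv x)) -> continuous dv ->
  \int[leb1]_(x in `]a, b[) (dp x * dv x) + beta * (p b * v b + p a * v a) =
  mu * \int[leb1]_(x in `]a, b[) (p x * v x).
Proof.
move=> ab [Dp Ddp _ pa pb] Dv cdv.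
have cv := is_derive_continuous Dv; have cp := is_derive_continuous Dp.
have cdp := is_derive_continuous Ddp.
have mI : measurable (`]a, b[%classic : set (measurableTypeR R)) by exact: measurable_itv.
have cM (f g : R -> R) : continuous f -> continuous g -> continuous (fun x => f x * g x).
  by move=> cf cg x; apply: cvgM; [exact: cf|exact: cg].
have i1 := continuous_integrable_itv a b (cM _ _ cdp cdv).
have i2 := continuous_integrable_itv a b (cM _ _ cp cv).
have : \int[leb1]_(x in `]a, b[) (dp x * dv x - mu * (p x * v x)) = dp b * v b - dp a * v a.
  apply: (@Rintegral_derive _ _ (fun x => dp x * v x)) => //.
    move=> x _; apply: is_derive_eq.
    by rewrite /GRing.scale /=; ring.
  apply: continuous_subspaceT => x.
  apply: cvgB; first exact: cM.
  by apply: cvgMl_tmp; exact: cM.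
rewrite RintegralB//; last by exact: (integrableZl mI mu i2).
rewrite RintegralZl// pa pb => E.
by lra.
Qed.

(** Picone's inequality: with [f = p'/p] the integrand
    [v'^2 - mu v^2 - (f v^2)' = (v' - f v)^2] is nonnegative, and the Robin
    condition prescribes [f] at both ends. *)
Lemma robin_mode_picone beta mu a b p dp v dv : a < b -> robin_mode beta mu a b p dp ->
  (forall x, is_derive x 1 v (dv x)) -> continuous dv ->
  mu * \int[leb1]_(x in `]a, b[) (v x ^+ 2) <=
  \int[leb1]_(x in `]a, b[) (dv x ^+ 2) + beta * (v b ^+ 2 + v a ^+ 2).
Proof.
move=> ab [Dp Ddp p0 pa pb] Dv cdv.
have cv := is_derive_continuous Dv; have cp := is_derive_continuous Dp.
have cdp := is_derive_continuous Ddp.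
have mI : measurable (`]a, b[%classic : set (measurableTypeR R)) by exact: measurable_itv.
have cX (f : R -> R) : continuous f -> continuous (fun x => f x ^+ 2).
  by move=> cf x; under eq_fun do rewrite expr2; apply: cvgM; exact: cf.
have i1 := continuous_integrable_itv a b (cX _ cdv).
have i2 := continuous_integrable_itv a b (cX _ cv).
(* [h] is the derivative of [(p' / p) v^2]. *)
pose h x := dv x ^+ 2 - mu * v x ^+ 2 - (dv x - dp x / p x * v x) ^+ 2.
have pN x : x \in `[a, b] -> p x != 0 by move=> /p0/lt0r_neq0.
have ch : {within `[a, b], continuous h}.
  apply/continuous_in_subspaceT => x /set_mem/= xab.
  have cq : {for x, continuous (fun x => dv x - dp x / p x * v x)}.
    apply: cvgB; first exact: cdv.
    apply: cvgM; last exact: cv.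
    by apply: cvgM; [exact: cdp|apply: cvgV; [exact: pN|exact: cp]].
  apply: cvgB; first apply: cvgB.
  - exact: cX.
  - by apply: cvgMl_tmp; exact: cX.
  - by under eq_fun do rewrite expr2; exact: cvgM.
have E : \int[leb1]_(x in `]a, b[) h x = dp b / p b * v b ^+ 2 - dp a / p a * v a ^+ 2.
  apply: (@Rintegral_derive _ _ (fun x => dp x / p x * v x ^+ 2)) => // x xab.
  have px := pN x xab.
  have Dpi := @is_deriveV _ p x (dp x) 1 px (Dp x).
  apply: is_derive_eq.
  rewrite /GRing.scale /h /=.
  by field.
have abb : b \in `[a, b] by rewrite in_itv/= lexx ltW.
have aab : a \in `[a, b] by rewrite in_itv/= lexx ltW.
have {}E : \int[leb1]_(x in `]a, b[) h x = - beta * (v b ^+ 2 + v a ^+ 2).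
  by rewrite E pa pb !mulfK ?pN//; ring.
have i3 : leb1.-integrable (`]a, b[ : set (measurableTypeR R)) (EFin \o h).
  have : leb1.-integrable (`[a, b] : set (measurableTypeR R)) (EFin \o h).
    by apply: continuous_compact_integrable => //; exact: segment_compact.
  by apply: integrableS => //; exact: subset_itv_oo_cc.
have i4 : leb1.-integrable (`]a, b[ : set (measurableTypeR R)) (EFin \o (fun x => mu * v x ^+ 2)).
  exact: (integrableZl mI mu i2).
rewrite -RintegralZl//.
suff : \int[leb1]_(x in `]a, b[) h x <=
    \int[leb1]_(x in `]a, b[) (dv x ^+ 2) - \int[leb1]_(x in `]a, b[) (mu * v x ^+ 2).
  by rewrite E; lra.
rewrite -RintegralB//; apply: le_Rintegral => //.
  exact: (integrableB mI i1 i4).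
by move=> x _; rewrite /h lerBlDr lerDl sqr_ge0.
Qed.

End interval.

(** * Separation of variables on a box *)

Section box_identities.
Context {R : realType}.
Local Notation plane := (@plane R).
Implicit Types (W Wx Wy : R * R -> R).

(** Continuous differentiability expressed through partial derivatives of the
    slices, which is what iterated integration consumes. *)
Definition C1 W Wx Wy : Prop :=
  [/\ continuous W, continuous Wx, continuous Wy,
      forall x y : R, is_derive x (1 : R) (fun s : R => W (s, y) : R) (Wx (x, y)) &
      forall x y : R, is_derive y (1 : R) (fun s : R => W (x, s) : R) (Wy (x, y))].

Lemma continuousM_plane (f g : R * R -> R) :
  continuous f -> continuous g -> continuous (fun z => f z * g z).
Proof. by move=> cf cg z; apply: cvgM; [exact: cf|exact: cg]. Qed.

Lemma continuousX_plane (f : R * R -> R) : continuous f -> continuous (fun z => f z ^+ 2).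
Proof. by move=> cf; under eq_fun do rewrite expr2; exact: continuousM_plane. Qed.

Lemma continuous_fst_comp (f : R -> R) : continuous f -> continuous (fun z : R * R => f z.1).
Proof. by move=> cf z; apply: (@continuous_comp _ _ _ fst f); [exact: cvg_fst|exact: cf]. Qed.

Lemma continuous_snd_comp (f : R -> R) : continuous f -> continuous (fun z : R * R => f z.2).
Proof. by move=> cf z; apply: (@continuous_comp _ _ _ snd f); [exact: cvg_snd|exact: cf]. Qed.

Variables (beta mu a b c d : R) (p dp : R -> R).
Hypotheses (ab : a < b) (cd : c < d) (hp : robin_mode beta mu a b p dp).
Variables (W Wx Wy : R * R -> R) (cW : C1 W Wx Wy).

Local Notation A := (`]a, b[%classic : set (measurableTypeR R)).
Local Notation B := (`]c, d[%classic : set (measurableTypeR R)).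
Let mA : measurable A. Proof. exact: measurable_itv. Qed.
Let mB : measurable B. Proof. exact: measurable_itv. Qed.
Let cp : continuous p.
Proof. by have [Dp _ _ _ _] := hp; exact: is_derive_continuous Dp. Qed.
Let cdp : continuous dp.
Proof. by have [_ Dp _ _ _] := hp; exact: is_derive_continuous Dp. Qed.

(** The one-dimensional identity on every horizontal line, integrated against
    [q]. *)
Lemma box_weak_x (q : R -> R) : continuous q ->
  \int[leb2]_(z in A `*` B) (dp z.1 * q z.2 * Wx z) +
    beta * (\int[leb1]_(y in B) (p b * q y * W (b, y)) + \int[leb1]_(y in B) (p a * q y * W (a, y))) =
  mu * \int[leb2]_(z in A `*` B) (p z.1 * q z.2 * W z).
Proof.
move=> cq; have [cW0 cWx _ DWx _] := cW.
have cf : continuous (fun z => dp z.1 * q z.2 * Wx z).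
  by do 2?apply: continuousM_plane => //; [exact: continuous_fst_comp|exact: continuous_snd_comp].
have cg : continuous (fun z => p z.1 * q z.2 * W z).
  by do 2?apply: continuousM_plane => //; [exact: continuous_fst_comp|exact: continuous_snd_comp].
have cy k x : continuous (fun y => k * q y * W (x, y)).
  move=> y; apply: cvgM; last exact: (@continuous_slice2 _ _ cW0 x).
  by apply: cvgMl_tmp; exact: cq.
rewrite -RintegralD//; [|exact: (continuous_integrable_itv c d (@cy (p b) b))|
  exact: (continuous_integrable_itv c d (@cy (p a) a))].
have ibdry : leb1.-integrable B (EFin \o (fun y => p b * q y * W (b, y) + p a * q y * W (a, y))).
  by apply: (@continuous_integrable_itv _ _ c d) => y; apply: cvgD; exact: cy.
rewrite -[beta * _]RintegralZl// (box_fubini1 cf) (box_fubini1 cg).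
rewrite -RintegralZl//; last exact: (integrable_slice1 cg a b c d).
rewrite -RintegralD//; last first.
- exact: (integrableZl mB beta ibdry).
- exact: (integrable_slice1 cf a b c d).
apply: eq_Rintegral => y _ /=.
have cx (g : R -> R) V : continuous g -> continuous V -> continuous (fun x => g x * V (x, y)).
  by move=> cg' cV x; apply: cvgM; [exact: cg'|exact: (@continuous_slice1 _ _ cV y)].
under eq_Rintegral do rewrite -mulrA (mulrCA _ (q y)).
rewrite RintegralZl//; last exact: (continuous_integrable_itv a b (@cx dp Wx cdp cWx)).
under [in RHS]eq_Rintegral do rewrite -mulrA (mulrCA _ (q y)).
rewrite RintegralZl//; last exact: (continuous_integrable_itv a b (@cx p W cp cW0)).
rewrite [RHS]mulrCA -(robin_mode_weak ab hp (fun x => DWx x y) (@continuous_slice1 _ _ cWx y)).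
by ring.
Qed.

Lemma box_picone_x :
  mu * \int[leb2]_(z in A `*` B) (W z ^+ 2) <=
  \int[leb2]_(z in A `*` B) (Wx z ^+ 2) +
    beta * (\int[leb1]_(y in B) (W (b, y) ^+ 2) + \int[leb1]_(y in B) (W (a, y) ^+ 2)).
Proof.
have [cW0 cWx _ DWx _] := cW.
have cf := continuousX_plane cWx; have cg := continuousX_plane cW0.
have cy x := @continuous_slice2 _ _ cg x.
rewrite -RintegralD//; [|exact: (continuous_integrable_itv c d (@cy b))|
  exact: (continuous_integrable_itv c d (@cy a))].
have ibdry : leb1.-integrable B (EFin \o (fun y => W (b, y) ^+ 2 + W (a, y) ^+ 2)).
  by apply: (@continuous_integrable_itv _ _ c d) => y; apply: cvgD; exact: cy.
have i1 := integrable_slice1 cf a b c d; have i2 := integrable_slice1 cg a b c d.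
rewrite -[beta * _]RintegralZl// (box_fubini1 cf) (box_fubini1 cg).
rewrite -RintegralZl// -RintegralD//; last exact: (integrableZl mB beta ibdry).
apply: le_Rintegral => //.
- exact: (integrableZl mB mu i2).
- exact: (integrableD mB i1 (integrableZl mB beta ibdry)).
- move=> y _; exact: (robin_mode_picone ab hp (fun x => DWx x y) (@continuous_slice1 _ _ cWx y)).
Qed.

End box_identities.

(** Exchanging the coordinates reduces statements about vertical lines to those
    about horizontal ones. *)
Section box_symmetry.
Context {R : realType}.
Local Notation plane := (@plane R).

Definition swap (z : R * R) : R * R := (z.2, z.1).

Lemma continuous_swap : continuous swap.
Proof. by move=> z; exact: cvg_pair cvg_snd cvg_fst. Qed.

Lemma C1_swap (W Wx Wy : R * R -> R) : C1 W Wx Wy -> C1 (W \o swap) (Wy \o swap) (Wx \o swap).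
Proof.
have cs (f : R * R -> R) : continuous f -> continuous (f \o swap).
  by move=> cf z; apply: continuous_comp; [exact: continuous_swap|exact: cf].
move=> [c0 c1 c2 Dx Dy]; split; [exact: cs c0|exact: cs c2|exact: cs c1| |] => x y.
  exact: Dy.
exact: Dx.
Qed.

Lemma Rintegral_swap (f : R * R -> R) a b c d : continuous f ->
  \int[leb2]_(z in (`]a, b[ `*` `]c, d[ : set plane)) f (swap z) =
  \int[leb2]_(z in (`]c, d[ `*` `]a, b[ : set plane)) f z.
Proof.
move=> cf; have cs : continuous (f \o swap).
  by move=> z; apply: continuous_comp; [exact: continuous_swap|exact: cf].
by rewrite (box_fubini1 cs) (box_fubini2 cf).
Qed.

End box_symmetry.

Section box_robin.
Context {R : realType}.
Local Notation plane := (@plane R).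
Variables (beta mu nu a b c d : R) (p dp q dq : R -> R).
Hypotheses (ab : a < b) (cd : c < d).
Hypotheses (hp : robin_mode beta mu a b p dp) (hq : robin_mode beta nu c d q dq).
Variables (W Wx Wy : R * R -> R) (cW : C1 W Wx Wy).

Local Notation A := (`]a, b[%classic : set (measurableTypeR R)).
Local Notation B := (`]c, d[%classic : set (measurableTypeR R)).
Let mAB : measurable (A `*` B). Proof. by apply: measurableX; exact: measurable_itv. Qed.

Definition box_boundary (f : R * R -> R) : R :=
  (\int[leb1]_(y in B) f (b, y) + \int[leb1]_(y in B) f (a, y)) +
  (\int[leb1]_(x in A) f (x, d) + \int[leb1]_(x in A) f (x, c)).

Lemma box_weak :
  \int[leb2]_(z in A `*` B) (dp z.1 * q z.2 * Wx z + p z.1 * dq z.2 * Wy z) +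
    beta * box_boundary (fun z => p z.1 * q z.2 * W z) =
  (mu + nu) * \int[leb2]_(z in A `*` B) (p z.1 * q z.2 * W z).
Proof.
have [cW0 cWx cWy _ _] := cW.
have [Dp Ddp _ _ _] := hp; have [Dq Ddq _ _ _] := hq.
have cp := is_derive_continuous Dp; have cdp := is_derive_continuous Ddp.
have cq := is_derive_continuous Dq; have cdq := is_derive_continuous Ddq.
have cc (f g : R -> R) V : continuous f -> continuous g -> continuous V ->
    continuous (fun z : R * R => f z.1 * g z.2 * V z).
  move=> cf cg cV; do 2?apply: continuousM_plane => //.
    exact: continuous_fst_comp.
  exact: continuous_snd_comp.
have E1 := box_weak_x c d ab hp cW cq.
have := box_weak_x a b cd hq (C1_swap cW) cp.
have swapE (f g : R -> R) V : continuous f -> continuous g -> continuous V ->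
    \int[leb2]_(z in `]c, d[ `*` `]a, b[) (g z.1 * f z.2 * V (swap z)) =
    \int[leb2]_(z in A `*` B) (f z.1 * g z.2 * V z).
  move=> cf cg cV; rewrite -[RHS](Rintegral_swap c d a b (cc _ _ _ cf cg cV)).
  by apply: eq_Rintegral => z _ /=; rewrite (mulrC (f _)).
rewrite !swapE// => E2.
rewrite RintegralD//; [|exact: continuous_integrable_box (cc _ _ _ cdp cq cWx)|
  exact: continuous_integrable_box (cc _ _ _ cp cdq cWy)].
rewrite mulrDl -E1 -E2 /box_boundary /=.
have -> : \int[leb1]_(y in `]a, b[) (q d * p y * (W \o swap) (d, y)) =
    \int[leb1]_(x in A) (p x * q d * W (x, d)).
  by apply: eq_Rintegral => x _; rewrite (mulrC (q d)).
have -> : \int[leb1]_(y in `]a, b[) (q c * p y * (W \o swap) (c, y)) =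
    \int[leb1]_(x in A) (p x * q c * W (x, c)).
  by apply: eq_Rintegral => x _; rewrite (mulrC (q c)).
by ring.
Qed.

Lemma box_rayleigh :
  (mu + nu) * \int[leb2]_(z in A `*` B) (W z ^+ 2) <=
  \int[leb2]_(z in A `*` B) (Wx z ^+ 2 + Wy z ^+ 2) +
    beta * box_boundary (fun z => W z ^+ 2).
Proof.
have [cW0 cWx cWy _ _] := cW.
have E1 := box_picone_x c d ab hp cW.
have := box_picone_x a b cd hq (C1_swap cW).
have swapE (V : R * R -> R) : continuous V ->
    \int[leb2]_(z in `]c, d[ `*` `]a, b[) ((V \o swap) z ^+ 2) =
    \int[leb2]_(z in A `*` B) (V z ^+ 2).
  by move=> cV; rewrite -[RHS](Rintegral_swap c d a b (continuousX_plane cV)).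
rewrite !swapE// => E2.
rewrite RintegralD//; [|exact: continuous_integrable_box (continuousX_plane cWx)|
  exact: continuous_integrable_box (continuousX_plane cWy)].
rewrite /box_boundary mulrDl.
apply: le_trans (lerD E1 E2) _.
by rewrite /swap /=; lra.
Qed.

End box_robin.

(** * Differential calculus in the plane *)

Section plane_calculus.
Context {R : realType}.
Local Notation plane := (@plane R).
Implicit Types (w : R * R -> R) (t : R).

Lemma is_derive_slice1 w (x y : R) : differentiable w (x, y) ->
  is_derive x (1 : R) (fun s : R => w (s, y) : R) (dx w (x, y)).
Proof.
move=> dw; have dw1 : derivable w (x, y) (1, 0) by exact: diff_derivable.
have E : (fun h : R => h^-1 *: (w (h *: (1 : R) + x, y) - w (x, y))) =
         (fun h : R => h^-1 *: (w (h *: ((1, 0) : R * R) + (x, y)) - w (x, y))).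
  apply/funext => h; congr (_ *: (w _ - _)); congr pair => /=.
  by rewrite /GRing.scale /= mulr0 add0r.
by split; [rewrite /derivable E|rewrite /dx /derive E].
Qed.

Lemma is_derive_slice2 w (x y : R) : differentiable w (x, y) ->
  is_derive y (1 : R) (fun s : R => w (x, s) : R) (dy w (x, y)).
Proof.
move=> dw; have dw1 : derivable w (x, y) (0, 1) by exact: diff_derivable.
have E : (fun h : R => h^-1 *: (w (x, h *: (1 : R) + y) - w (x, y))) =
         (fun h : R => h^-1 *: (w (h *: ((0, 1) : R * R) + (x, y)) - w (x, y))).
  apply/funext => h; congr (_ *: (w _ - _)); congr pair => /=.
  by rewrite /GRing.scale /= mulr0 add0r.
by split; [rewrite /derivable E|rewrite /dy /derive E].
Qed.

(** The difference quotients on both sides coincide, [rotation t] being linear. *)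
Lemma derive_rotation w t (z v : R * R) :
  'D_v (w \o rotation t) z = 'D_(rotation t v) w (rotation t z).
Proof.
have E : (fun h : R => h^-1 *: ((w \o rotation t) (h *: v + z) - (w \o rotation t) z)) =
         (fun h : R => h^-1 *: (w (h *: rotation t v + rotation t z) - w (rotation t z))).
  apply/funext => h /=; congr (_ *: (w _ - _)).
  by rewrite /rotation /GRing.scale /=; congr pair => /=; rewrite /GRing.scale /=; ring.
by rewrite /derive E.
Qed.

Lemma derive_plane w (z : R * R) (a b : R) : differentiable w z ->
  'D_((a, b) : R * R) w z = a * dx w z + b * dy w z.
Proof.
move=> dw; rewrite /dx /dy !deriveE//.
have -> : ((a, b) : R * R) = a *: ((1, 0) : R * R) + b *: ((0, 1) : R * R).
  by congr pair; rewrite /= /GRing.scale /= ?mulr1 ?mulr0 ?addr0 ?add0r.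
by rewrite linearD !linearZ.
Qed.

Lemma dx_rotation w t z : differentiable w (rotation t z) ->
  dx (w \o rotation t) z = cos t * dx w (rotation t z) + sin t * dy w (rotation t z).
Proof.
move=> dw; rewrite -derive_plane// /dx derive_rotation.
by congr ('D_(_) w _); rewrite /rotation /= !mulr1 !mulr0 subr0 addr0.
Qed.

Lemma dy_rotation w t z : differentiable w (rotation t z) ->
  dy (w \o rotation t) z = - sin t * dx w (rotation t z) + cos t * dy w (rotation t z).
Proof.
move=> dw; rewrite -derive_plane// /dy derive_rotation.
by congr ('D_(_) w _); rewrite /rotation /= !mulr1 !mulr0 sub0r add0r.
Qed.

Lemma differentiable_fst (z : R * R) : differentiable (fst : R * R -> R) z.
Proof. by apply: linear_differentiable => x; exact: cvg_fst. Qed.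

Lemma differentiable_snd (z : R * R) : differentiable (snd : R * R -> R) z.
Proof. by apply: linear_differentiable => x; exact: cvg_snd. Qed.

Lemma differentiable_rotation t z : differentiable (rotation t : R * R -> R * R) z.
Proof.
apply: differentiable_pair.
  by apply: differentiableB; apply: differentiableZ; [exact: differentiable_fst|exact: differentiable_snd].
by apply: differentiableD; apply: differentiableZ; [exact: differentiable_fst|exact: differentiable_snd].
Qed.

Lemma Ck1_continuous w : Ck 1 w -> continuous w.
Proof. by move=> [dw _ _] z; exact: differentiable_continuous. Qed.

Lemma Ck1_C1 w : Ck 1 w -> C1 w (dx w) (dy w).
Proof.
move=> cw; have [dw cx cy] := cw; split => //; first exact: Ck1_continuous.
- by move=> x y; exact: is_derive_slice1.
- by move=> x y; exact: is_derive_slice2.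
Qed.

Lemma Ck1_rotation w t : Ck 1 w -> Ck 1 (w \o rotation t).
Proof.
move=> [dw cx cy].
have cr (f : R * R -> R) : continuous f -> continuous (fun z => f (rotation t z)).
  by move=> cf z; apply: continuous_comp; [exact: rotation_continuous|exact: cf].
split.
- move=> z; apply: differentiable_comp; [exact: differentiable_rotation|exact: dw].
- rewrite /= (_ : dx _ = fun z => cos t * dx w (rotation t z) + sin t * dy w (rotation t z)).
    by move=> z; apply: cvgD; apply: cvgMl_tmp; exact: cr.
  by apply/funext => z; rewrite dx_rotation.
- rewrite /= (_ : dy _ = fun z => - sin t * dx w (rotation t z) + cos t * dy w (rotation t z)).
    by move=> z; apply: cvgD; apply: cvgMl_tmp; exact: cr.
  by apply/funext => z; rewrite dy_rotation.
Qed.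

Lemma Ck1M (f g : R * R -> R) : Ck 1 f -> Ck 1 g -> Ck 1 (f * g).
Proof.
move=> cf cg; have [df cfx cfy] := cf; have [dg cgx cgy] := cg.
have cf0 := Ck1_continuous cf; have cg0 := Ck1_continuous cg.
split.
- by move=> z; exact: differentiableM.
- rewrite /= (_ : dx _ = fun z => f z * dx g z + g z * dx f z).
    by move=> z; apply: cvgD; exact: continuousM_plane.
  by apply/funext => z; rewrite /dx deriveM//; exact: diff_derivable.
- rewrite /= (_ : dy _ = fun z => f z * dy g z + g z * dy f z).
    by move=> z; apply: cvgD; exact: continuousM_plane.
  by apply/funext => z; rewrite /dy deriveM//; exact: diff_derivable.
Qed.

Lemma dxM (f g : R * R -> R) z : Ck 1 f -> Ck 1 g ->
  dx (f * g) z = f z * dx g z + g z * dx f z.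
Proof. by move=> [df _ _] [dg _ _]; rewrite /dx deriveM//; exact: diff_derivable. Qed.

Lemma dyM (f g : R * R -> R) z : Ck 1 f -> Ck 1 g ->
  dy (f * g) z = f z * dy g z + g z * dy f z.
Proof. by move=> [df _ _] [dg _ _]; rewrite /dy deriveM//; exact: diff_derivable. Qed.

Section tensor.
Variables p dp q dq : R -> R.
Hypotheses (Dp : forall x : R, is_derive x 1 p (dp x)) (Dq : forall x : R, is_derive x 1 q (dq x)).
Hypotheses (cdp : continuous dp) (cdq : continuous dq).

Definition tensor (z : R * R) : R := p z.1 * q z.2.

Let dtensor z : differentiable tensor z.
Proof.
have dp1 : differentiable (fun z : R * R => p z.1) z.
  apply: (@differentiable_comp _ _ _ _ fst p); first exact: differentiable_fst.
  by apply/derivable1_diffP; have [] := Dp z.1.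
have dq1 : differentiable (fun z : R * R => q z.2) z.
  apply: (@differentiable_comp _ _ _ _ snd q); first exact: differentiable_snd.
  by apply/derivable1_diffP; have [] := Dq z.2.
exact: differentiableM.
Qed.

Lemma dx_tensor z : dx tensor z = dp z.1 * q z.2.
Proof.
case: z => x y /=; have [_ <-] := is_derive_slice1 (dtensor (x, y)).
have [_ E] := is_deriveM (Dp x) (is_derive_cst (q y) x (1 : R)).
by apply: etrans E _; rewrite scaler0 add0r /GRing.scale /= mulrC.
Qed.

Lemma dy_tensor z : dy tensor z = p z.1 * dq z.2.
Proof.
case: z => x y /=; have [_ <-] := is_derive_slice2 (dtensor (x, y)).
have [_ E] := is_deriveM (is_derive_cst (p x) y (1 : R)) (Dq y).
by apply: etrans E _; rewrite scaler0 addr0 /GRing.scale.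
Qed.

Lemma Ck1_tensor : Ck 1 tensor.
Proof.
have cp := is_derive_continuous Dp; have cq := is_derive_continuous Dq.
split; first exact: dtensor.
- rewrite /= (_ : dx _ = fun z => dp z.1 * q z.2); last exact/funext/dx_tensor.
  by apply: continuousM_plane; [exact: continuous_fst_comp|exact: continuous_snd_comp].
- rewrite /= (_ : dy _ = fun z => p z.1 * dq z.2); last exact/funext/dy_tensor.
  by apply: continuousM_plane; [exact: continuous_fst_comp|exact: continuous_snd_comp].
Qed.

End tensor.

End plane_calculus.

(** * Smooth functions in the Sobolev space *)

Section weak_gradient_of_C1.
Context {R : realType}.
Local Notation plane := (@plane R).

(** The support of [f] is compact, so the fundamental theorem of calculus on the
    lines of a large box leaves no boundary term. *)
Lemma integral_dx_compact_support (f : R * R -> R) (K : set (R * R)) (Om : set plane) :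
  Ck 1 f -> compact K -> K `<=` Om -> (forall z, ~ K z -> f z = 0) ->
  \int[leb2]_(z in Om) dx f z = 0 /\ \int[leb2]_(z in Om) dy f z = 0.
Proof.
move=> cf cK KOm f0.
have oK : open (~` K).
  by apply: closed_openC; apply: compact_closed cK; exact: norm_hausdorff.
have near0 z : ~ K z -> \near z, f z = cst 0 z.
  move=> Kz; apply: filterS (open_nbhs_nbhs (conj oK Kz)) => z' /f0 //.
have dx0 z : ~ K z -> dx f z = 0 by move=> /near0 fz; rewrite /dx (near_eq_derive _ fz) derive_cst.
have dy0 z : ~ K z -> dy f z = 0 by move=> /near0 fz; rewrite /dy (near_eq_derive _ fz) derive_cst.
have [M1 HM1] : exists M, forall z, K z -> `|z.1| <= M :> R.
  by apply: continuous_compact_bounded => // z; exact: cvg_fst.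
have [M2 HM2] : exists M, forall z, K z -> `|z.2| <= M :> R.
  by apply: continuous_compact_bounded => // z; exact: cvg_snd.
(* Strictly beyond the bounds, so that [f] vanishes on the sides of the box. *)
pose M := Num.max 0 (Num.max M1 M2) + 1.
have M0 : 0 < M by rewrite /M ltr_wpDl// le_max lexx.
have KM z : K z -> (z.1 \in `]-M, M[) /\ (z.2 \in `]-M, M[).
  move=> Kz; have := HM1 _ Kz; have := HM2 _ Kz.
  rewrite !in_itv/= -!ltr_norml /M => h2 h1.
  have : Num.max M1 M2 <= Num.max 0 (Num.max M1 M2) by rewrite le_max lexx orbT.
  by rewrite ge_max => /andP[? ?]; split; lra.
pose B : set plane := `]-M, M[ `*` `]-M, M[.
have KB : K `<=` B by move=> z /KM[].
have toB (g : R * R -> R) : (forall z, ~ K z -> g z = 0) ->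
    \int[leb2]_(z in Om) g z = \int[leb2]_(z in B) g z.
  move=> g0; rewrite Rintegral_mkcond [RHS]Rintegral_mkcond.
  congr (Rintegral _ _ _); apply/funext => z; rewrite !patchE.
  have [Kz|Kz] := pselect (K z); first by rewrite !mem_set//; [exact: KB|exact: KOm].
  by rewrite g0// !if_same.
have [_ cdx cdy Dx Dy] := Ck1_C1 cf.
have ltM : - M < M by lra.
rewrite (toB _ dx0) (toB _ dy0) (box_fubini1 cdx) (box_fubini2 cdy); split.
  rewrite -[RHS](@Rintegral_set0 _ _ _ (@lebesgue_measure R) (cst 0)) [RHS]Rintegral_mkcond Rintegral_mkcond.
  congr (Rintegral _ _ _); apply/funext => y; rewrite !patchE in_set0; case: ifP => // _.
  rewrite (Rintegral_derive ltM (fun x _ => Dx x y)); last first.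
    by apply: continuous_subspaceT; exact: (@continuous_slice1 _ _ cdx y).
  by rewrite !f0 ?subrr// => /KM[]; rewrite in_itv/= ltxx ?andbF.
rewrite -[RHS](@Rintegral_set0 _ _ _ (@lebesgue_measure R) (cst 0)) [RHS]Rintegral_mkcond Rintegral_mkcond.
congr (Rintegral _ _ _); apply/funext => x; rewrite !patchE in_set0; case: ifP => // _.
rewrite (Rintegral_derive ltM (fun y _ => Dy x y)); last first.
  by apply: continuous_subspaceT; exact: (@continuous_slice2 _ _ cdy x).
by rewrite !f0 ?subrr// => /KM[_]; rewrite in_itv/= ltxx ?andbF.
Qed.

(** The weak gradient is the classical one: [u * phi] has compact support. *)
Lemma Ck1_H1 (r : rectangle R) (u : R * R -> R) : Ck 1 u ->
  H1 (region r) u (fun z => (dx u z, dy u z)).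
Proof.
move=> cu; have [_ cdx cdy] := cu; have cu0 := Ck1_continuous cu.
split; [exact: (continuous_L2_region r cu0)|exact: (continuous_L2_region r cdx)|
  exact: (continuous_L2_region r cdy)|].
move=> phi [cphi [K [cK KOm phi0]]].
have cphi1 := cphi 1%N; have [_ cpx cpy] := cphi1; have cphi0 := Ck1_continuous cphi1.
have up0 z : ~ K z -> (u * phi) z = 0.
  by move=> /phi0 E; rewrite -[LHS]/(u z * phi z) E mulr0.
have mr := measurable_region r.
have int (f g : R * R -> R) : continuous f -> continuous g ->
    leb2.-integrable (region r : set plane) (EFin \o (fun z => f z * g z)).
  by move=> cf cg; apply: continuous_integrable_region; exact: continuousM_plane.
have [Ex Ey] := integral_dx_compact_support (Ck1M cu cphi1) cK KOm up0.
split; apply/eqP; rewrite -addr_eq0; apply/eqP.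
- rewrite -(RintegralD mr (int _ _ cu0 cpx) (int _ _ cdx cphi0)).
  by rewrite -[RHS]Ex; apply: eq_Rintegral => z _ /=; rewrite dxM// [phi z * _]mulrC.
- rewrite -(RintegralD mr (int _ _ cu0 cpy) (int _ _ cdy cphi0)).
  by rewrite -[RHS]Ey; apply: eq_Rintegral => z _ /=; rewrite dyM// [phi z * _]mulrC.
Qed.

End weak_gradient_of_C1.

Section boundary.
Context {R : realType}.
Local Notation plane := (@plane R).
Implicit Types (r : rectangle R).

Lemma boundary_intE r (f : R * R -> R) :
  boundary_int r f =
    box_boundary (xmin r) (xmax r) (ymin r) (ymax r) (f \o rotation (angle r)).
Proof.
rewrite /boundary_int /box_boundary.
rewrite -(pair_big xpredT xpredT (fun i j =>
  \int[leb1]_(x in side_dom r (i, j)) f (side r (i, j) x))) /= !big_bool /=.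
by rewrite addrC.
Qed.

Lemma perimeterE r :
  perimeter r = 2 * ((xmax r - xmin r) + (ymax r - ymin r)).
Proof.
have hx := xmin_lt_xmax r; have hy := ymin_lt_ymax r.
have E (a b : R) : a < b -> \int[leb1]_(x in `]a, b[) 1 = b - a.
  move=> ab; rewrite Rintegral_cst/=; last exact: measurable_itv.
  by rewrite mul1r lebesgue_measure_itv/= lte_fin ab.
rewrite /perimeter boundary_intE /box_boundary /= !E//; ring.
Qed.

Lemma areaE r : area r = (xmax r - xmin r) * (ymax r - ymin r).
Proof. by rewrite /area leb2_region. Qed.

Lemma continuous_side r (f : R * R -> R) i : continuous f -> continuous (f \o side r i).
Proof.
move=> cf x; apply: continuous_comp; last exact: cf.
rewrite /side; case: i => -[] j /=;
  apply: (@continuous_comp _ _ _ _ (rotation (angle r))); try exact: rotation_continuous.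
- exact: cvg_pair cvg_id (cvg_cst _).
- exact: cvg_pair (cvg_cst _) cvg_id.
Qed.

Lemma measurable_side_dom r i : measurable (side_dom r i : set (measurableTypeR R)).
Proof. by rewrite /side_dom; case: i.1; exact: measurable_itv. Qed.

Lemma continuous_boundary_L2 r (f : R * R -> R) : continuous f -> boundary_L2 r f.
Proof.
move=> cf i; have := @continuous_side r f i cf; rewrite /side_dom; case: i => -[] j /= c;
  exact: continuous_L2_itv.
Qed.

Lemma Ck1_H1_with_trace r (u : R * R -> R) : Ck 1 u ->
  H1_with_trace r u (fun z => (dx u z, dy u z)) u.
Proof.
move=> cu; have cu0 := Ck1_continuous cu; split; first exact: Ck1_H1.
split; first exact: continuous_boundary_L2.
(* The constant sequence [u] converges to [u] in every required sense. *)
exists (fun=> u); split=> //; apply: cvg_near_cst; apply: nearW => n.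
- by rewrite integral0_eq// => z _; rewrite subrr expr0n.
- by rewrite integral0_eq// => z _; rewrite /= !subrr !expr0n addr0.
- rewrite /eboundary_int big1// => i _.
  by rewrite integral0_eq// => z _; rewrite subrr expr0n.
Qed.

End boundary.

(** * The first Robin eigenvalue of a rectangle *)

(** The common shape of the two passages to the limit below: two gradient terms
    and a boundary term against a mass term. *)
Section limits_of_energies.
Context {R : realType}.
Variables (f1 f2 f3 g : nat -> R) (a1 a2 a3 b beta lam : R).
Hypotheses (f1a : f1 n @[n --> \oo] --> a1) (f2a : f2 n @[n --> \oo] --> a2).
Hypotheses (f3a : f3 n @[n --> \oo] --> a3) (gb : g n @[n --> \oo] --> b).

Let lhs : f1 n + f2 n + beta * f3 n @[n --> \oo] --> a1 + a2 + beta * a3.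
Proof. by apply: cvgD; [exact: cvgD|exact: cvgMl_tmp]. Qed.

Let rhs : lam * g n @[n --> \oo] --> lam * b.
Proof. exact: cvgMl_tmp. Qed.

Lemma lim_energy_eq : (forall n, f1 n + f2 n + beta * f3 n = lam * g n) ->
  a1 + a2 + beta * a3 = lam * b.
Proof.
by move=> /funext fg; apply: (cvg_unique (@Rhausdorff R) lhs); rewrite fg.
Qed.

Lemma lim_energy_ge : (forall n, lam * g n <= f1 n + f2 n + beta * f3 n) ->
  lam * b <= a1 + a2 + beta * a3.
Proof.
move=> fg; rewrite -(cvg_lim (@Rhausdorff R) lhs) -(cvg_lim (@Rhausdorff R) rhs).
apply: ler_lim; [by apply/cvg_ex; eexists; exact: rhs|by apply/cvg_ex; eexists; exact: lhs|].
exact: nearW.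
Qed.

End limits_of_energies.

Section ground_state.
Context {R : realType}.
Local Notation plane := (@plane R).
Variables (r : rectangle R) (beta mu nu : R) (p dp q dq : R -> R).
Hypotheses (hp : robin_mode beta mu (xmin r) (xmax r) p dp).
Hypotheses (hq : robin_mode beta nu (ymin r) (ymax r) q dq).
Let Om := region r.
Let mOm : measurable (Om : set plane). Proof. exact: measurable_region. Qed.

Definition ground_state : R * R -> R := tensor p q \o rotation (- angle r).
Let u := ground_state.

Let Dp (x : R) : is_derive x 1 p (dp x). Proof. by have [] := hp. Qed.
Let Dq (x : R) : is_derive x 1 q (dq x). Proof. by have [] := hq. Qed.
Let cdp : continuous dp. Proof. by have [_ D _ _ _] := hp; exact: is_derive_continuous D. Qed.
Let cdq : continuous dq. Proof. by have [_ D _ _ _] := hq; exact: is_derive_continuous D. Qed.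

Lemma ground_state_Ck1 : Ck 1 u.
Proof. by apply: Ck1_rotation; exact: Ck1_tensor. Qed.

Lemma ground_stateE z : u (rotation (angle r) z) = p z.1 * q z.2.
Proof. by rewrite /u /ground_state /= rotationK. Qed.

Let rotE (w : R * R -> R) : Ck 1 w ->
  C1 (w \o rotation (angle r)) (dx (w \o rotation (angle r))) (dy (w \o rotation (angle r))).
Proof. by move=> cw; apply: Ck1_C1; exact: Ck1_rotation. Qed.

(** A rotation acts on gradients by an orthogonal matrix. *)
Lemma gradient_rotation (f g : R * R -> R) t z : Ck 1 f -> Ck 1 g ->
  dx (f \o rotation t) z * dx (g \o rotation t) z +
  dy (f \o rotation t) z * dy (g \o rotation t) z =
  dx f (rotation t z) * dx g (rotation t z) + dy f (rotation t z) * dy g (rotation t z).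
Proof.
move=> [df _ _] [dg _ _]; rewrite (dx_rotation (df _)) (dx_rotation (dg _)) (dy_rotation (df _)) (dy_rotation (dg _)).
move: (dx f _) (dy f _) (dx g _) (dy g _) => a b c d.
transitivity ((cos t ^+ 2 + sin t ^+ 2) * (a * c + b * d)); first ring.
by rewrite cos2Dsin2 mul1r.
Qed.

Lemma ground_state_weak_C1 (w : R * R -> R) : Ck 1 w ->
  \int[leb2]_(z in Om) (dx u z * dx w z + dy u z * dy w z) +
    beta * boundary_int r (fun z => u z * w z) =
  (mu + nu) * \int[leb2]_(z in Om) (u z * w z).
Proof.
move=> cw; have cu := ground_state_Ck1.
have [_ cux cuy] := cu; have [_ cwx cwy] := cw.
have cu0 := Ck1_continuous cu; have cw0 := Ck1_continuous cw.
rewrite !Rintegral_region; last 2 first.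
- by apply: measurable_funTS; apply: continuous_measurable_plane; exact: continuousM_plane.
- apply: measurable_funTS; apply: continuous_measurable_plane => z.
  by apply: cvgD; exact: continuousM_plane.
rewrite boundary_intE /box.
have := box_weak (xmin_lt_xmax r) (ymin_lt_ymax r) hp hq (rotE cw).
have uE : u \o rotation (angle r) = tensor p q.
  by apply/funext => z; rewrite /= ground_stateE.
have -> : (fun z => u z * w z) \o rotation (angle r) =
    (fun z => p z.1 * q z.2 * (w \o rotation (angle r)) z).
  by apply/funext => z /=; rewrite ground_stateE.
under [in X in _ = X -> _]eq_Rintegral do rewrite /= -ground_stateE.
move=> <-; apply: (f_equal (fun i => i + _)); apply: eq_Rintegral => z _.
apply: etrans (esym (gradient_rotation (angle r) z cu cw)) _.
by rewrite uE (dx_tensor Dp Dq z) (dy_tensor Dp Dq z).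
Qed.

Lemma ground_state_rayleigh_C1 (w : R * R -> R) : Ck 1 w ->
  (mu + nu) * \int[leb2]_(z in Om) (w z ^+ 2) <=
  \int[leb2]_(z in Om) (dx w z ^+ 2 + dy w z ^+ 2) +
    beta * boundary_int r (fun z => w z ^+ 2).
Proof.
move=> cw; have [_ cwx cwy] := cw; have cw0 := Ck1_continuous cw.
rewrite !Rintegral_region; last 2 first.
- apply: measurable_funTS; apply: continuous_measurable_plane => z.
  by apply: cvgD; exact: continuousX_plane.
- by apply: measurable_funTS; apply: continuous_measurable_plane; exact: continuousX_plane.
rewrite boundary_intE /box.
apply: le_trans (box_rayleigh (xmin_lt_xmax r) (ymin_lt_ymax r) hp hq (rotE cw)) _.
rewrite lerD2r; rewrite le_eqVlt; apply/predU1P; left; apply: eq_Rintegral => z _.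
exact: (gradient_rotation (angle r) z cw cw).
Qed.

Section limits.
Variables (v : R * R -> R) (h : R * R -> R * R) (s : R * R -> R).
Hypothesis vhs : H1_with_trace r v h s.

(* The convergence of gradients and traces, component by component. *)
Let approx : exists w : nat -> R * R -> R,
  [/\ forall n, Ck 1 (w n),
    (\int[leb2]_(z in Om) ((w n z - v z) ^+ 2)%:E)%E @[n --> \oo] --> 0%E,
    (\int[leb2]_(z in Om) ((dx (w n) z - (h z).1) ^+ 2)%:E)%E @[n --> \oo] --> 0%E,
    (\int[leb2]_(z in Om) ((dy (w n) z - (h z).2) ^+ 2)%:E)%E @[n --> \oo] --> 0%E &
    forall i, (\int[leb1]_(x in side_dom r i)
      (((w n \o side r i) x - (s \o side r i) x) ^+ 2)%:E)%E @[n --> \oo] --> 0%E].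
Proof.
have [[Lv Lh1 Lh2 _] [Ls [w [cw wv gv sv]]]] := vhs.
have mx n : measurable_fun Om (fun z => dx (w n) z - (h z).1).
  have [_ cx _] := cw n; have [mh _] := Lh1; apply: measurable_funB => //.
  by apply: measurable_funTS; exact: continuous_measurable_plane.
have my n : measurable_fun Om (fun z => dy (w n) z - (h z).2).
  have [_ _ cy] := cw n; have [mh _] := Lh2; apply: measurable_funB => //.
  by apply: measurable_funTS; exact: continuous_measurable_plane.
have component (e : nat -> R * R -> R) : (forall n, measurable_fun Om (e n)) ->
    (forall n z, e n z ^+ 2 <= (dx (w n) z - (h z).1) ^+ 2 + (dy (w n) z - (h z).2) ^+ 2) ->
    (\int[leb2]_(z in Om) (e n z ^+ 2)%:E)%E @[n --> \oo] --> 0%E.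
  move=> me le_e; apply: (squeeze_cvge _ (cvg_cst _) gv); apply: nearW => n.
  apply/andP; split; first by apply: integral_ge0 => z _; rewrite lee_fin sqr_ge0.
  apply: ge0_le_integral => //.
  - by move=> z _; rewrite lee_fin sqr_ge0.
  - by apply/measurable_EFinP; apply: measurable_funX; exact: me.
  - apply/measurable_EFinP; apply: measurable_funD; apply: measurable_funX.
      exact: mx.
    exact: my.
  - by move=> z _; rewrite lee_fin le_e.
exists w; split => //.
- by apply: component => // n z; rewrite lerDl sqr_ge0.
- by apply: component => // n z; rewrite lerDr sqr_ge0.
- move=> i; apply: (squeeze_cvge _ (cvg_cst _) sv); apply: nearW => n.
  apply/andP; split; first by apply: integral_ge0 => z _; rewrite lee_fin sqr_ge0.
  rewrite /eboundary_int (bigD1 i)//= leeDl//; apply: sume_ge0 => j _.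
  by apply: integral_ge0 => z _; rewrite lee_fin sqr_ge0.
Qed.

Let L2v : L2 leb2 Om v. Proof. by have [[]] := vhs. Qed.
Let L2h1 : L2 leb2 Om (fun z => (h z).1). Proof. by have [[]] := vhs. Qed.
Let L2h2 : L2 leb2 Om (fun z => (h z).2). Proof. by have [[]] := vhs. Qed.
Let L2s : boundary_L2 r s. Proof. by have [_ []] := vhs. Qed.

(** Both sides of [ground_state_weak_C1] are continuous in the test function. *)
Lemma ground_state_weak :
  \int[leb2]_(z in Om) (dx u z * (h z).1 + dy u z * (h z).2) +
    beta * boundary_int r (fun z => u z * s z) =
  (mu + nu) * \int[leb2]_(z in Om) (u z * v z).
Proof.
have cu := ground_state_Ck1; have [_ cux cuy] := cu; have cu0 := Ck1_continuous cu.
have [w [cw wv gx gy ws]] := approx.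
have Lw n : L2 leb2 Om (w n) by apply: continuous_L2_region; exact: Ck1_continuous.
have Lwx n : L2 leb2 Om (dx (w n)) by have [_ ? _] := cw n; exact: continuous_L2_region.
have Lwy n : L2 leb2 Om (dy (w n)) by have [_ _ ?] := cw n; exact: continuous_L2_region.
have Lu : L2 leb2 Om u by exact: continuous_L2_region.
have Lux : L2 leb2 Om (dx u) by exact: continuous_L2_region.
have Luy : L2 leb2 Om (dy u) by exact: continuous_L2_region.
have C0 := L2_cvg_mul mOm Lw L2v Lu wv.
have Cx := L2_cvg_mul mOm Lwx L2h1 Lux gx.
have Cy := L2_cvg_mul mOm Lwy L2h2 Luy gy.
have Cs : boundary_int r (fun z => u z * w n z) @[n --> \oo] --> boundary_int r (fun z => u z * s z).
  apply: cvg_big => [|i _]; first exact: add_continuous.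
  have Lus := continuous_boundary_L2 r cu0 i.
  have Lws n := continuous_boundary_L2 r (Ck1_continuous (cw n)) i.
  exact: (L2_cvg_mul (@measurable_side_dom _ r i) Lws (L2s i) Lus (ws i)).
rewrite (RintegralD mOm (L2_integrable_mul mOm Lux L2h1) (L2_integrable_mul mOm Luy L2h2)).
apply: (lim_energy_eq Cx Cy Cs C0) => n; apply: etrans (ground_state_weak_C1 (cw n)).
by rewrite (RintegralD mOm (L2_integrable_mul mOm Lux (Lwx n)) (L2_integrable_mul mOm Luy (Lwy n))).
Qed.

Lemma ground_state_rayleigh :
  (mu + nu) * \int[leb2]_(z in Om) (v z ^+ 2) <=
  \int[leb2]_(z in Om) ((h z).1 ^+ 2 + (h z).2 ^+ 2) +
    beta * boundary_int r (fun z => s z ^+ 2).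
Proof.
have [w [cw wv gx gy ws]] := approx.
have Lw n : L2 leb2 Om (w n) by apply: continuous_L2_region; exact: Ck1_continuous.
have Lwx n : L2 leb2 Om (dx (w n)) by have [_ ? _] := cw n; exact: continuous_L2_region.
have Lwy n : L2 leb2 Om (dy (w n)) by have [_ _ ?] := cw n; exact: continuous_L2_region.
have C0 := L2_cvg_sqr mOm Lw L2v wv.
have Cx := L2_cvg_sqr mOm Lwx L2h1 gx.
have Cy := L2_cvg_sqr mOm Lwy L2h2 gy.
have Cs : boundary_int r (fun z => w n z ^+ 2) @[n --> \oo] --> boundary_int r (fun z => s z ^+ 2).
  apply: cvg_big => [|i _]; first exact: add_continuous.
  have Lws n := continuous_boundary_L2 r (Ck1_continuous (cw n)) i.
  exact: (L2_cvg_sqr (@measurable_side_dom _ r i) Lws (L2s i) (ws i)).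
rewrite (RintegralD mOm (L2_sqr_integrable mOm L2h1) (L2_sqr_integrable mOm L2h2)).
apply: (lim_energy_ge Cx Cy Cs C0) => n; apply: le_trans (ground_state_rayleigh_C1 (cw n)) _.
by rewrite (RintegralD mOm (L2_sqr_integrable mOm (Lwx n)) (L2_sqr_integrable mOm (Lwy n))).
Qed.

End limits.

Lemma ground_state_gt0 z : Om z -> 0 < u z.
Proof.
rewrite /Om regionE => -[/= zx zy].
have [_ _ p0 _ _] := hp; have [_ _ q0 _ _] := hq.
by apply: mulr_gt0; [apply: p0|apply: q0]; exact: subset_itv_oo_cc.
Qed.

Lemma area_gt0 : (0 < leb2 Om)%E.
Proof.
by rewrite leb2_region lte_fin mulr_gt0 ?subr_gt0 ?xmin_lt_xmax ?ymin_lt_ymax.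
Qed.

(** The product of two positive one-dimensional modes is a positive
    eigenfunction, and Picone's inequality shows that nothing lies below. *)
Lemma robin_lambda1E : robin_lambda1 r beta = mu + nu.
Proof.
have cu := ground_state_Ck1.
have ev : robin_eigenvalue r beta (mu + nu).
  exists u, (fun z => (dx u z, dy u z)), u; split.
  - exact: Ck1_H1_with_trace.
  - move=> [N [mN N0 subN]].
    have : (leb2 Om <= leb2 N)%E.
      apply: le_measure; rewrite ?inE//; apply: subset_trans subN => z Oz /= /(_ Oz).
      by have /lt0r_neq0/eqP := ground_state_gt0 Oz.
    by rewrite leNgt [X in (X < _)%E]N0 area_gt0.
  - by move=> v h s vhs /=; exact: ground_state_weak vhs.
have lb : lbound (robin_eigenvalue r beta) (mu + nu).
  move=> lam [v [h [s [vhs vN0 weak]]]].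
  have W : \int[leb2]_(z in Om) ((h z).1 ^+ 2 + (h z).2 ^+ 2) +
      beta * boundary_int r (fun z => s z ^+ 2) = lam * \int[leb2]_(z in Om) (v z ^+ 2).
    exact: (weak _ _ _ vhs).
  have := ground_state_rayleigh vhs; rewrite W ler_pM2r//.
  have Lv : L2 leb2 Om v by have [[]] := vhs.
  rewrite lt_def Rintegral_ge0 ?andbT; last by move=> z _; exact: sqr_ge0.
  apply/negP => /eqP v0; apply: vN0.
  have iv := L2_sqr_integrable mOm Lv.
  have ve : (\int[leb2]_(z in Om) `|(EFin \o (fun z => (v z ^+ 2)%R)) z| = 0)%E.
    under eq_integral do rewrite /= ger0_norm ?sqr_ge0//.
    have fv := integrable_fin_num mOm iv.
    by rewrite -[LHS](fineK fv); congr (_%:E).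
  have := (ae_eq_integral_abs _ mOm (measurable_int _ iv)).1 ve.
  apply: filterS => z vz Oz; have /= := vz Oz => -[]/eqP.
  by rewrite sqrf_eq0 => /eqP.
rewrite /robin_lambda1; case: xgetP => [lam _ [elam lblam]|/(_ (mu + nu))[]//].
by apply/eqP; rewrite eq_le lb// lblam.
Qed.

End ground_state.

(** * Convexity along the eigenvalue equation *)

Section monotonicity.
Context {R : realType}.
Implicit Types (f df : R -> R) (a b : R).

Lemma derive_ge0_le f df a b : a <= b ->
  (forall t, t \in `[a, b] -> is_derive t 1 f (df t)) ->
  (forall t, t \in `[a, b] -> 0 <= df t) -> f a <= f b.
Proof.
move=> ab Df df0.
have cf : {within `[a, b], continuous f}.
  apply/continuous_in_subspaceT => x /set_mem/= xab.
  apply: differentiable_continuous; apply/derivable1_diffP.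
  by have [] := Df x xab.
have [t tab E] := MVT_segment ab (fun t tab => Df t (subset_itv_oo_cc tab)) cf.
by rewrite -subr_ge0 E mulr_ge0 ?df0// subr_ge0.
Qed.

Lemma derive_gt0_lt f df a b : a < b ->
  (forall t, t \in `[a, b] -> is_derive t 1 f (df t)) ->
  (forall t, t \in `]a, b[ -> 0 < df t) -> f a < f b.
Proof.
move=> ab Df df0.
have cf : {within `[a, b], continuous f}.
  apply/continuous_in_subspaceT => x /set_mem/= xab.
  apply: differentiable_continuous; apply/derivable1_diffP.
  by have [] := Df x xab.
have [t tab E] := MVT ab (fun t tab => Df t (subset_itv_oo_cc tab)) cf.
by rewrite -subr_gt0 E mulr_gt0 ?df0// subr_gt0.
Qed.

End monotonicity.

Section oscillators.
Context {R : realType}.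

(** The pair [(cos, sin)] for [kappa = 1] and [(cosh, sinh)] for [kappa = -1]. *)
Definition oscillator (kappa : R) (c s : R -> R) : Prop :=
  [/\ kappa = 1 \/ kappa = -1,
      (forall x : R, is_derive x 1 c (- kappa * s x)) /\ (forall x : R, is_derive x 1 s (c x)),
      forall x, kappa * s x ^+ 2 + c x ^+ 2 = 1,
      s 0 = 0 /\ c 0 = 1 &
      forall x, s (- x) = - s x /\ c (- x) = c x].

Lemma oscillator_trig : oscillator 1 (@cos R) sin.
Proof.
split; first by left.
- by split=> x; apply: is_derive_eq; rewrite ?mulN1r.
- by move=> x; rewrite mul1r addrC cos2Dsin2.
- by rewrite sin0 cos0.
- by move=> x; rewrite sinN cosN.
Qed.

Definition cosh (x : R) := (expR x + expR (- x)) / 2.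
Definition sinh (x : R) := (expR x - expR (- x)) / 2.

Lemma is_derive_expRN (x : R) : is_derive x 1 (fun x => expR (- x)) (- expR (- x)).
Proof.
have D : is_derive (- x) 1 (@expR R) (expR (- x)) by apply: is_derive_expR.
have := is_derive1_comp D (is_deriveN (is_derive_id x 1)).
by move=> h; apply: is_derive_eq; rewrite /GRing.scale /= mulrN1.
Qed.

Lemma oscillator_hyp : oscillator (-1) cosh sinh.
Proof.
have E x : expR x * expR (- x) = 1 :> R by rewrite -expRD subrr expR0.
split; first by right.
- split=> x; have D := is_derive_expRN x; rewrite /cosh /sinh; apply: is_derive_eq;
    by rewrite /GRing.scale /=; field.
- move=> x; rewrite /cosh /sinh; transitivity (expR x * expR (- x)); last exact: E.
  by field.
- by rewrite /cosh /sinh oppr0 expR0; split; field.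
- by move=> x; rewrite /cosh /sinh opprK; split; field.
Qed.

Variables (kappa : R) (c s : R -> R).
Hypothesis osc : oscillator kappa c s.

Let kappa2 : kappa ^+ 2 = 1.
Proof. by have [[->|->] _ _ _ _] := osc; rewrite ?sqrrN expr1n. Qed.
Let Dc (x : R) : is_derive x 1 c (- kappa * s x). Proof. by have [_ []] := osc. Qed.
Let Ds (x : R) : is_derive x 1 s (c x). Proof. by have [_ []] := osc. Qed.
Let cs1 x : kappa * s x ^+ 2 + c x ^+ 2 = 1. Proof. by have [_ _ ->] := osc. Qed.
Let s0 : s 0 = 0. Proof. by have [_ _ _ []] := osc. Qed.
Let c0 : c 0 = 1. Proof. by have [_ _ _ []] := osc. Qed.

(** The range of phases on which the eigenvalue equation is solved: up to
    [pi / 2] for the cosine, unbounded for the hyperbolic cosine. *)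
Definition positive_phase (x : R) : Prop := 0 < x /\ forall t, t \in `[0, x] -> 0 < c t.

Lemma positive_phase_le x y : 0 < x <= y -> positive_phase y -> positive_phase x.
Proof.
move=> /andP[x0 xy] [_ cy]; split=> // t; rewrite in_itv/= => /andP[t0 tx].
by apply: cy; rewrite in_itv/= t0 (le_trans tx).
Qed.

Lemma positive_phase_c x : positive_phase x -> 0 < c x.
Proof. by move=> [x0]; apply; rewrite in_itv/= lexx ltW. Qed.

Lemma positive_phase_s x : positive_phase x -> 0 < s x.
Proof.
move=> [x0 cx]; rewrite -s0; apply: (derive_gt0_lt x0 (fun t _ => Ds t)) => t tx.
by apply: cx; exact: subset_itv_oo_cc.
Qed.

Lemma nonneg_of_derive (f df : R -> R) x : 0 <= x -> f 0 = 0 ->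
  (forall t : R, is_derive t 1 f (df t)) ->
  (forall t, 0 <= t <= x -> 0 <= df t) -> 0 <= f x.
Proof.
move=> x0 f0 Df df0; rewrite -f0; apply: (derive_ge0_le x0 (fun t _ => Df t)) => t.
by rewrite in_itv/=; exact: df0.
Qed.

(* Half the sine and the cosine of the doubled angle. *)
Let m x := s x * c x.
Let C x := c x ^+ 2 - kappa * s x ^+ 2.

Let Dm (x : R) : is_derive x 1 m (C x).
Proof. by move: Ds Dc => ? ?; rewrite /m /C; apply: is_derive_eq; rewrite /GRing.scale /=; ring. Qed.
Let DC (x : R) : is_derive x 1 C (- 4 * kappa * m x).
Proof. by move: Ds Dc => ? ?; rewrite /m /C; apply: is_derive_eq; rewrite /GRing.scale /=; ring. Qed.
Let m0 : m 0 = 0. Proof. by rewrite /m s0 mul0r. Qed.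
Let C0 : C 0 = 1. Proof. by rewrite /C s0 c0; ring. Qed.
Let Cm1 x : 4 * kappa * m x ^+ 2 + C x ^+ 2 = 1.
Proof.
transitivity ((kappa * s x ^+ 2 + c x ^+ 2) ^+ 2); first by rewrite /m /C; ring.
by rewrite cs1 expr1n.
Qed.
Let CE x : 1 + C x = 2 * c x ^+ 2.
Proof. by have := cs1 x; rewrite /C; lra. Qed.

(** The derivative of [kappa (x - m x)] is [2 (s x)^2]. *)
Lemma gap_ge0 x : 0 <= x -> 0 <= kappa * (x - m x).
Proof.
move=> x0; apply: (@nonneg_of_derive (fun x => kappa * (x - m x)) (fun x => 2 * s x ^+ 2) x x0).
- by rewrite m0 subrr mulr0.
- move: Dm => ? t; apply: is_derive_eq; rewrite /GRing.scale /= /C.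
  transitivity (2 * kappa ^+ 2 * s t ^+ 2 + kappa * (1 - (kappa * s t ^+ 2 + c t ^+ 2))); first by ring.
  by rewrite kappa2 cs1; ring.
- by move=> t _; have := sqr_ge0 (s t); lra.
Qed.

(* Taylor bounds, obtained from one another by integration from [0]. *)
Let C_hyp x : kappa = -1 -> 0 <= x -> 1 <= C x.
Proof.
by move=> k _; have := cs1 x; have := sqr_ge0 (s x); rewrite /C k; lra.
Qed.

Let m_hyp x : kappa = -1 -> 0 <= x -> 0 <= m x - x.
Proof.
move=> k x0; apply: (@nonneg_of_derive (fun x => m x - x) (fun x => C x - 1) x x0).
- by rewrite m0 subrr.
- by move: Dm => ? t; apply: is_derive_eq.
- by move=> t /andP[t0 _]; rewrite subr_ge0 C_hyp.
Qed.

Let C_hyp2 x : kappa = -1 -> 0 <= x -> 0 <= C x - 1 - 2 * x ^+ 2.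
Proof.
move=> k x0.
apply: (@nonneg_of_derive (fun x => C x - 1 - 2 * x ^+ 2) (fun x => 4 * (m x - x)) x x0).
- by rewrite C0; ring.
- move: DC => ? t; apply: is_derive_eq; rewrite /GRing.scale /= k; ring.
- by move=> t /andP[t0 _]; rewrite mulr_ge0// m_hyp.
Qed.

Let m_hyp3 x : kappa = -1 -> 0 <= x -> 0 <= m x - x - 2 / 3 * x ^+ 3.
Proof.
move=> k x0.
apply: (@nonneg_of_derive (fun x => m x - x - 2 / 3 * x ^+ 3) (fun x => C x - 1 - 2 * x ^+ 2) x x0).
- by rewrite m0; ring.
- by move: Dm => ? t; apply: is_derive_eq; rewrite /GRing.scale /=; field.
- by move=> t /andP[t0 _]; rewrite C_hyp2.
Qed.

Let m_trig x : kappa = 1 -> 0 <= x -> 0 <= x - m x.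
Proof. by move=> k x0; have := gap_ge0 x0; rewrite k mul1r. Qed.

Let C_trig2 x : kappa = 1 -> 0 <= x -> 0 <= C x - 1 + 2 * x ^+ 2.
Proof.
move=> k x0.
apply: (@nonneg_of_derive (fun x => C x - 1 + 2 * x ^+ 2) (fun x => 4 * (x - m x)) x x0).
- by rewrite C0; ring.
- move: DC => ? t; apply: is_derive_eq; rewrite /GRing.scale /= k; ring.
- by move=> t /andP[t0 _]; rewrite mulr_ge0// m_trig.
Qed.

Let m_trig3 x : kappa = 1 -> 0 <= x -> 0 <= m x - x + 2 / 3 * x ^+ 3.
Proof.
move=> k x0.
apply: (@nonneg_of_derive (fun x => m x - x + 2 / 3 * x ^+ 3) (fun x => C x - 1 + 2 * x ^+ 2) x x0).
- by rewrite m0; ring.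
- by move: Dm => ? t; apply: is_derive_eq; rewrite /GRing.scale /=; field.
- by move=> t /andP[t0 _]; rewrite C_trig2.
Qed.

Let C_trig4 x : kappa = 1 -> 0 <= x -> 0 <= 1 - 2 * x ^+ 2 + 2 / 3 * x ^+ 4 - C x.
Proof.
move=> k x0.
apply: (@nonneg_of_derive (fun x => 1 - 2 * x ^+ 2 + 2 / 3 * x ^+ 4 - C x)
  (fun x => 4 * (m x - x + 2 / 3 * x ^+ 3)) x x0).
- by rewrite C0; ring.
- by move: DC => ? t; apply: is_derive_eq; rewrite /GRing.scale /= k; field.
- by move=> t /andP[t0 _]; rewrite mulr_ge0// m_trig3.
Qed.

Let m_trig5 x : kappa = 1 -> 0 <= x -> 0 <= x - 2 / 3 * x ^+ 3 + 2 / 15 * x ^+ 5 - m x.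
Proof.
move=> k x0.
apply: (@nonneg_of_derive (fun x => x - 2 / 3 * x ^+ 3 + 2 / 15 * x ^+ 5 - m x)
  (fun x => 1 - 2 * x ^+ 2 + 2 / 3 * x ^+ 4 - C x) x x0).
- by rewrite m0; ring.
- by move: Dm => ? t; apply: is_derive_eq; rewrite /GRing.scale /=; field.
- by move=> t /andP[t0 _]; rewrite C_trig4.
Qed.

(* The factor of the derivative of [slope] on which its sign depends. *)
Let key (x : R) := 2 * x ^+ 3 + 2 * m x * c x ^+ 2 * x ^+ 2 - 3 * x * m x ^+ 2 - m x ^+ 3.

Let key_hyp x : kappa = -1 -> 0 <= x -> key x <= 0.
Proof.
move=> k x0; rewrite /key.
have mx := m_hyp k x0; have m3 := m_hyp3 k x0; have C2 := C_hyp2 k x0.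
have E := Cm1 x; have EC := CE x; rewrite k in E.
move: (m x) (C x) (c x ^+ 2) mx m3 C2 E EC => M D d mx m3 C2 E EC.
(* Since [4 M^2 = D^2 - 1] and [M - x >= 2 x^3 / 3], this is at least
   [((D - 2 x^2)^2 - 1) / 4 + x^4]. *)
have I0 : 0 <= M ^+ 2 - x ^+ 2 * D + 3 * x * (M - x).
  have e1 : 1 <= (D - 2 * x ^+ 2) ^+ 2 by nra.
  have e2 : 0 <= x * (M - x - 2 / 3 * x ^+ 3) by rewrite mulr_ge0.
  have e3 : 0 <= x ^+ 4 by rewrite exprn_ge0.
  nra.
have M0 : 0 <= M by lra.
have e4 : 0 <= M * (M ^+ 2 - x ^+ 2 * D + 3 * x * (M - x)) by rewrite mulr_ge0.
have e5 : 0 <= x ^+ 2 * (M - x) by rewrite mulr_ge0// exprn_ge0.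
rewrite (_ : _ - M ^+ 3 = - (M * (M ^+ 2 - x ^+ 2 * D + 3 * x * (M - x)) + 2 * (x ^+ 2 * (M - x)))).
  by lra.
rewrite (_ : 2 * M * d = M * (1 + D)); last by rewrite EC; ring.
ring.
Qed.

Let key_trig x : kappa = 1 -> 0 <= x -> 0 <= m x -> 0 <= key x.
Proof.
move=> k x0 M0; rewrite /key.
have mx := m_trig k x0; have m5 := m_trig5 k x0; have C2 := C_trig2 k x0.
have E := Cm1 x; have EC := CE x; have d0 := sqr_ge0 (c x); rewrite k in E.
move: (m x) (C x) (c x ^+ 2) M0 mx m5 C2 E EC d0 => M D d M0 mx m5 C2 E EC d0.
have x4 : 0 <= x ^+ 4 by rewrite exprn_ge0.
have x3 : 0 <= x ^+ 3 by rewrite exprn_ge0.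
rewrite (_ : 2 * M * d = M * (1 + D)); last by rewrite EC; ring.
(* Taylor bounds suffice up to [1]; beyond, [M <= 1 / 2] does. *)
have [x1|x1] := leP x 1.
  (* Since [4 M^2 = 1 - D^2], this is at least
     [((D + 2 x^2)^2 - 1) / 4 + x^4 (7 / 3 - 2 x^2 / 3)]. *)
  have II : 0 <= x ^+ 2 * D - M ^+ 2 + 5 * x * (x - M).
    have e1 : 1 <= (D + 2 * x ^+ 2) ^+ 2 by nra.
    have e2 : 0 <= x * (x - 2 / 3 * x ^+ 3 + 2 / 15 * x ^+ 5 - M) by rewrite mulr_ge0.
    have e3 : 0 <= x ^+ 4 * (1 - x ^+ 2) by rewrite mulr_ge0// subr_ge0 expr_le1.
    nra.
  have e4 : 0 <= M * (x ^+ 2 * D - M ^+ 2 + 5 * x * (x - M)) by rewrite mulr_ge0.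
  have e5 : 0 <= x * (x - M) ^+ 2 by rewrite mulr_ge0// sqr_ge0.
  rewrite (_ : _ - M ^+ 3 = M * (x ^+ 2 * D - M ^+ 2 + 5 * x * (x - M)) + 2 * (x * (x - M) ^+ 2)).
    by lra.
  ring.
have M2 : M <= 1 / 2 by have := sqr_ge0 D; nra.
have e1 : 0 <= M * (1 + D) * x ^+ 2 by rewrite mulr_ge0 ?sqr_ge0// mulr_ge0// EC mulr_ge0.
have e2 : x * M ^+ 2 <= x * (1 / 4) by rewrite ler_wpM2l//; nra.
have e3 : M ^+ 3 <= 1 / 8.
  by rewrite (_ : 1 / 8 = (1 / 2) ^+ 3); [rewrite lerXn2r// ?nnegrE; lra|field].
have e4 : x <= x ^+ 3 by rewrite -[leLHS]expr1 ler_weXn2l// ltW.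
lra.
Qed.

Let key_ge0 x : positive_phase x -> 0 <= kappa * key x.
Proof.
move=> ph; have [x0 _] := ph; have [kE _ _ _ _] := osc.
have M0 : 0 <= m x by rewrite mulr_ge0 ?ltW// ?positive_phase_s// positive_phase_c.
case: kE => k; rewrite k ?mul1r ?mulN1r.
  by rewrite key_trig// ltW.
by rewrite oppr_ge0 key_hyp// ltW.
Qed.

Let gap_gt0 x : positive_phase x -> 0 < kappa * (x - m x).
Proof.
move=> ph; have [x0 cx] := ph.
have -> : 0 = kappa * (0 - m 0) by rewrite m0; ring.
apply: (@derive_gt0_lt _ (fun x => kappa * (x - m x)) (fun x => 2 * s x ^+ 2) _ _ x0).
- move: Dm => ? t _; apply: is_derive_eq; rewrite /GRing.scale /= /C.
  transitivity (2 * kappa ^+ 2 * s t ^+ 2 + kappa * (1 - (kappa * s t ^+ 2 + c t ^+ 2))); first by ring.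
  by rewrite kappa2 cs1; ring.
- move=> t; rewrite in_itv/= => /andP[t0 tx].
  by rewrite mulr_gt0// exprn_gt0// positive_phase_s//; apply: (@positive_phase_le t x) => //; rewrite t0 ltW.
Qed.

Let phase_m x : positive_phase x -> 0 < m x.
Proof. by move=> ph; rewrite mulr_gt0 ?positive_phase_s ?positive_phase_c. Qed.

(** The mode [t |-> c (k t)] on an interval of length [l] centred at [0], of phase
    [x = k l / 2] at the ends, satisfies the Robin condition with parameter
    [kappa * 2 * load x / l]; [level x] is the quotient [x^2 / load x]. *)
Definition load x := x * s x / c x.
Definition level x := x * c x / s x.

(** This is [- 3 kappa] times the derivative of [level] with respect to the cube
    of [load]. *)
Definition slope x :=
  kappa * (c x / s x) ^+ 4 * (x - s x * c x) / (x ^+ 2 * (x + s x * c x)).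

Let Dcot x : s x != 0 -> is_derive x 1 (fun x => c x / s x) (- (s x ^+ 2)^-1).
Proof.
move=> sx; have Di := @is_deriveV _ s x (c x) 1 sx (Ds x).
move: Dc => ?; apply: is_derive_eq; rewrite /GRing.scale /=.
transitivity (- ((kappa * s x ^+ 2 + c x ^+ 2) / s x ^+ 2)); first by field.
by rewrite cs1 mul1r.
Qed.

Let Dtan x : c x != 0 -> is_derive x 1 (fun x => s x / c x) ((c x ^+ 2)^-1).
Proof.
move=> cx; have Di := @is_deriveV _ c x (- kappa * s x) 1 cx (Dc x).
move: Ds => ?; apply: is_derive_eq; rewrite /GRing.scale /=.
transitivity ((kappa * s x ^+ 2 + c x ^+ 2) / c x ^+ 2); first by field.
by rewrite cs1 mul1r.
Qed.

Let slope_gt0 x : positive_phase x -> 0 < slope x.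
Proof.
move=> ph; have [x0 _] := ph; have sx := positive_phase_s ph; have cx := positive_phase_c ph.
rewrite /slope [X in X / _](_ : _ = (c x / s x) ^+ 4 * (kappa * (x - m x))); last first.
  by rewrite /m; ring.
by rewrite divr_gt0// mulr_gt0 ?gap_gt0 ?exprn_gt0 ?divr_gt0// addr_gt0 ?mulr_gt0.
Qed.

Let dslope x := - (2 * c x ^+ 3 / (s x ^+ 5 * x ^+ 3 * (x + m x) ^+ 2)) * (kappa * key x).

Let Dslope x : positive_phase x -> is_derive x 1 slope (dslope x).
Proof.
move=> ph; have [x0 _] := ph; have sx := positive_phase_s ph; have cx := positive_phase_c ph.
have sN := lt0r_neq0 sx; have xN := lt0r_neq0 x0.
have mx := phase_m ph.
have DN : x ^+ 2 * (x + m x) != 0 by rewrite lt0r_neq0// mulr_gt0 ?exprn_gt0 ?addr_gt0.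
have D1 := Dcot sN.
have D2 : is_derive x 1 (fun x => x ^+ 2 * (x + m x)) (2 * x * (x + m x) + x ^+ 2 * (2 * c x ^+ 2)).
  have := Dm x => ?; apply: is_derive_eq; rewrite /GRing.scale /= -CE; ring.
have D3 : is_derive x 1 (fun x => x - m x) (1 - C x).
  by have := Dm x => ?; apply: is_derive_eq.
have D4 := @is_deriveV _ (fun x => x ^+ 2 * (x + m x)) x _ 1 DN D2.
rewrite (_ : slope = fun x => kappa * (c x / s x) ^+ 4 * (x - m x) * (x ^+ 2 * (x + m x))^-1)//.
apply: is_derive_eq; rewrite /GRing.scale /=.
have CE' : 1 - C x = 2 * (kappa * s x ^+ 2) by have := cs1 x; rewrite /C; lra.
rewrite CE' /dslope.
have keyE : key x = - (- 2 * x * (x - m x) * (x + m x) + m x * x * (kappa * s x ^+ 2) * (x + m x) -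
    m x * (x - m x) * (x + m x + x * c x ^+ 2)).
  have -> : kappa * s x ^+ 2 = 1 - c x ^+ 2 by have := cs1 x; lra.
  by rewrite /key; ring.
rewrite keyE /m; field.
by rewrite sN xN /= lt0r_neq0// addr_gt0.
Qed.

(** The derivative of [slope] is a negative multiple of [kappa * key]. *)
Lemma slope_decreasing x y : positive_phase y -> 0 < x <= y -> slope y <= slope x.
Proof.
move=> ph /andP[x0 xy].
have sub t : t \in `[x, y] -> positive_phase t.
  rewrite in_itv/= => /andP[xt ty]; apply: (positive_phase_le _ ph).
  by rewrite (lt_le_trans x0 xt).
rewrite -lerN2.
apply: (@derive_ge0_le _ (fun t => - slope t) (fun t => - dslope t) _ _ xy).
- by move=> t /sub pt; have := Dslope pt => ?; apply: is_derive_eq.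
- move=> t /sub pt; have [t0 _] := pt.
  have st := positive_phase_s pt; have ct := positive_phase_c pt; have mt := phase_m pt.
  rewrite /dslope mulNr opprK mulr_ge0 ?key_ge0//.
  by rewrite divr_ge0 ?mulr_ge0 ?exprn_ge0 ?addr_ge0// ltW.
Qed.

Let tangent_gap w x := kappa * level x + slope w / 3 * load x ^+ 3.

Let Dtangent_gap w x : positive_phase x ->
  is_derive x 1 (tangent_gap w)
    (load x ^+ 2 * (x + m x) / c x ^+ 2 * (slope w - slope x)).
Proof.
move=> ph; have [x0 _] := ph; have sx := positive_phase_s ph; have cx := positive_phase_c ph.
have sN := lt0r_neq0 sx; have cN := lt0r_neq0 cx; have xN := lt0r_neq0 x0.
have D1 := Dcot sN; have D2 := Dtan cN.
rewrite (_ : tangent_gap w = fun x => kappa * (x * (c x / s x)) + slope w / 3 * (x * (s x / c x)) ^+ 3); last first.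
  by apply/funext => t; rewrite /tangent_gap /level /load !mulrA.
apply: is_derive_eq; rewrite /GRing.scale /=.
rewrite /slope -/(slope w) /load /m.
by field; rewrite sN cN xN /= lt0r_neq0// addr_gt0// mulr_gt0.
Qed.

(** [kappa * level] lies above its tangent when expressed through the cube of
    [load]: the derivative of the difference is a positive multiple of
    [slope w - slope x], which changes sign only at [w]. *)
Lemma level_tangent w x : positive_phase w -> positive_phase x ->
  kappa * level w + slope w / 3 * load w ^+ 3 <= kappa * level x + slope w / 3 * load x ^+ 3.
Proof.
move=> pw px; have [w0 _] := pw; have [x0 _] := px.
have pos t : positive_phase t -> 0 <= load t ^+ 2 * (t + m t) / c t ^+ 2.
  move=> pt; have [t0 _] := pt; have ct := positive_phase_c pt; have mt := phase_m pt.
  have tm : 0 <= t + m t by rewrite ltW// addr_gt0.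
  by apply: divr_ge0; [apply: mulr_ge0 => //; exact: sqr_ge0|exact: sqr_ge0].
have [wx|/ltW xw] := leP w x.
  have sub t : t \in `[w, x] -> positive_phase t /\ w <= t.
    rewrite in_itv/= => /andP[wt tx]; split=> //; apply: (positive_phase_le _ px).
    by rewrite (lt_le_trans w0 wt).
  apply: (derive_ge0_le wx (fun t tt => Dtangent_gap w (sub t tt).1)) => t /sub[pt wt].
  by rewrite mulr_ge0 ?pos// subr_ge0 slope_decreasing// w0.
have sub t : t \in `[x, w] -> positive_phase t /\ t <= w.
  rewrite in_itv/= => /andP[xt tw]; split=> //; apply: (positive_phase_le _ pw).
  by rewrite (lt_le_trans x0 xt).
rewrite -lerN2.
apply: (@derive_ge0_le _ (fun t => - tangent_gap w t)
  (fun t => load t ^+ 2 * (t + m t) / c t ^+ 2 * (slope t - slope w)) _ _ xw).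
- move=> t /sub[pt _]; have := Dtangent_gap w pt => ?; apply: is_derive_eq.
  by rewrite -mulrN opprB.
- move=> t /sub[pt tw]; rewrite mulr_ge0 ?pos// subr_ge0 slope_decreasing//.
  by have [-> _] := pt.
Qed.

Lemma load_gt0 x : positive_phase x -> 0 < load x.
Proof.
move=> px; have [x0 _] := px.
by rewrite /load divr_gt0 ?mulr_gt0 ?positive_phase_s ?positive_phase_c.
Qed.

(** Adding the tangent inequalities at [x] and [y] with weights [load y] and
    [load x] leaves a multiple of [2 W^4 - X Y (X^2 + Y^2)], where [X], [Y], [W]
    are the loads; as [W] is the mean of [X] and [Y], this is [(X - Y)^4 / 8]. *)
Lemma level_mean_gt x y w : positive_phase x -> positive_phase y -> positive_phase w ->
  load x + load y = 2 * load w -> load x != load y ->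
  kappa * (2 * load w * level w) < kappa * (load y * level x + load x * level y).
Proof.
move=> px py pw xyw xy.
have Hx := level_tangent pw px; have Hy := level_tangent pw py.
have lx := load_gt0 px; have ly := load_gt0 py; have sw := slope_gt0 pw.
move: (load x) (load y) (load w) (level x) (level y) (level w) (slope w) xyw xy Hx Hy lx ly sw.
move=> X Y W hx hy hw b xyw xy Hx Hy lx ly sw.
have e1 : 0 <= Y * (kappa * hx + b / 3 * X ^+ 3 - (kappa * hw + b / 3 * W ^+ 3)).
  by apply: mulr_ge0; [exact: ltW|rewrite subr_ge0].
have e2 : 0 <= X * (kappa * hy + b / 3 * Y ^+ 3 - (kappa * hw + b / 3 * W ^+ 3)).
  by apply: mulr_ge0; [exact: ltW|rewrite subr_ge0].
have e3 : 0 < b * (X - Y) ^+ 4.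
  by rewrite mulr_gt0// lt_def exprn_even_ge0// expf_neq0// subr_eq0.
have WE : W = (X + Y) / 2 by rewrite xyw; field.
rewrite -subr_gt0.
rewrite [X in 0 < X](_ : _ = Y * (kappa * hx + b / 3 * X ^+ 3 - (kappa * hw + b / 3 * W ^+ 3)) +
  X * (kappa * hy + b / 3 * Y ^+ 3 - (kappa * hw + b / 3 * W ^+ 3)) + b * (X - Y) ^+ 4 / 24).
  by rewrite ltr_wpDl ?divr_gt0// addr_ge0.
by rewrite WE; field.
Qed.

End oscillators.

(** * Eigenvalues in terms of loads *)

Section robin_phase.
Context {R : realType}.

(** Clearing the denominator of [load] makes the intermediate value theorem
    applicable on the closed interval, including [pi / 2]. *)
Lemma trig_phase (y : R) : 0 < y -> exists2 x, positive_phase cos x & load cos sin x = y.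
Proof.
move=> y0; have p0 := pi_gt0 R; have hp0 : 0 <= pi / 2 :> R by lra.
have cf : {within `[0, pi / 2], continuous (fun x => x * sin x - y * cos x : R)}.
  apply: continuous_subspaceT => x; apply: cvgB; apply: cvgM.
  - exact: cvg_id.
  - exact: continuous_sin.
  - exact: cvg_cst.
  - exact: continuous_cos.
have [|x xin E] := @IVT _ _ _ _ 0 hp0 cf.
  rewrite sin0 cos0 sin_pihalf cos_pihalf mul0r mulr1 mulr0 mulr1 sub0r subr0.
  by rewrite ge_min le_max oppr_le0 (ltW y0) hp0 orbT.
move: xin; rewrite in_itv/= => /andP[x0 xpi].
have {}x0 : 0 < x.
  rewrite lt_def x0 andbT; apply: contra_eq_neq E => ->.
  by rewrite cos0 mul0r sub0r mulr1 oppr_eq0 lt0r_neq0.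
have {}xpi : x < pi / 2.
  rewrite lt_def xpi andbT; apply: contra_eq_neq E => <-.
  by rewrite sin_pihalf cos_pihalf mulr1 mulr0 subr0 lt0r_neq0//; lra.
have cp t : 0 <= t <= x -> 0 < cos t by move=> /andP[t0 tx]; apply: cos_gt0_pihalf; lra.
exists x; first by split=> // t; rewrite in_itv/=; exact: cp.
have cx : 0 < cos x by apply: cp; rewrite lexx ltW.
by apply: (mulIf (lt0r_neq0 cx)); rewrite /load divfK ?lt0r_neq0//; lra.
Qed.

Lemma cosh_gt0 (x : R) : 0 < cosh x.
Proof. by rewrite /cosh divr_gt0// addr_gt0 ?expR_gt0. Qed.

Lemma hyp_phase (y : R) : 0 < y -> exists2 x, positive_phase cosh x & load cosh sinh x = y.
Proof.
(* As [tanh X >= 1 / 2], the load exceeds [y] at [X]. *)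
move=> y0; pose X := 2 * y + 1; have X0 : 0 <= X by rewrite /X; lra.
have [_ [Dc Ds] _ [s0 c0] _] := @oscillator_hyp R.
have cf : {within `[0, X], continuous (fun x => x * sinh x - y * cosh x : R)}.
  apply: continuous_subspaceT => x; apply: cvgB; apply: cvgM.
  - exact: cvg_id.
  - exact: is_derive_continuous Ds x.
  - exact: cvg_cst.
  - exact: is_derive_continuous Dc x.
have fX : 0 <= X * sinh X - y * cosh X.
  have e1 : 1 <= expR X by rewrite -expR0 ler_expR.
  have e2 : 1 + X <= expR X := expR_ge1Dx X.
  have e3 : expR X * expR (- X) = 1 by rewrite -expRD subrr expR0.
  have e4 : 0 < expR (- X) by exact: expR_gt0.
  have e5 : expR (- X) <= 1 by rewrite -expR0 ler_expR; lra.
  rewrite /sinh /cosh.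
  have e6 : 2 * expR (- X) <= 1.
    have : (1 + X) * expR (- X) <= expR X * expR (- X) by rewrite ler_wpM2r// ltW.
    rewrite e3.
    have : 0 <= 2 * y * expR (- X) by rewrite mulr_ge0 ?mulr_ge0 // ltW.
    by rewrite /X; nra.
  move: (expR X) (expR (- X)) e1 e2 e4 e5 e6 => a b e1 e2 e4 e5 e6.
  by rewrite /X in e2 *; nra.
have [|x xin E] := @IVT _ _ _ _ 0 X0 cf.
  by rewrite s0 c0 mul0r mulr1 sub0r ge_min le_max oppr_le0 (ltW y0) fX orbT.
move: xin; rewrite in_itv/= => /andP[x0 _].
have {}x0 : 0 < x.
  rewrite lt_def x0 andbT; apply: contra_eq_neq E => ->.
  by rewrite c0 mul0r sub0r mulr1 oppr_eq0 lt0r_neq0.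
exists x; first by split=> // t _; exact: cosh_gt0.
have cx := cosh_gt0 x.
by apply: (mulIf (lt0r_neq0 cx)); rewrite /load divfK ?lt0r_neq0//; lra.
Qed.

Lemma oscillator_of_sign (alpha : R) : alpha != 0 ->
  exists kappa c s, [/\ oscillator kappa c s, alpha = kappa * `|alpha| &
    forall y, 0 < y -> exists2 x, positive_phase c x & load c s x = y].
Proof.
rewrite neq_lt => /orP[a0|a0].
  exists (-1), cosh, sinh; split; [exact: oscillator_hyp| |exact: hyp_phase].
  by rewrite ltr0_norm// mulN1r opprK.
exists 1, cos, sin; split; [exact: oscillator_trig| |exact: trig_phase].
by rewrite gtr0_norm// mul1r.
Qed.

Variables (kappa : R) (c s : R -> R).
Hypothesis osc : oscillator kappa c s.

Lemma robin_mode_phase a b x (k := 2 * x / (b - a)) : a < b -> positive_phase c x ->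
  robin_mode (kappa * (2 * load c s x / (b - a))) (kappa * k ^+ 2) a b
    (fun t => c (k * (t - (a + b) / 2))) (fun t => - kappa * k * s (k * (t - (a + b) / 2))).
Proof.
move=> ab ph; have [x0 cpos] := ph.
have [_ [Dc Ds] _ _ par] := osc.
have cx := lt0r_neq0 (positive_phase_c ph).
have l0 : 0 < b - a by rewrite subr_gt0.
have lN := lt0r_neq0 l0.
have k0 : 0 < k by rewrite divr_gt0 ?mulr_gt0.
have kb : k * (b - (a + b) / 2) = x by rewrite /k; field.
have ka : k * (a - (a + b) / 2) = - x by rewrite /k; field.
have Dl (t : R) : is_derive t 1 (fun t => k * (t - (a + b) / 2)) k.
  by apply: is_derive_eq; rewrite /GRing.scale /=; ring.
split.
- move=> t; have D1 := @is_derive1_comp _ c (fun t => k * (t - (a + b) / 2)) _ _ _ (Dc _) (Dl t).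
  by apply: (is_derive_eq D1); rewrite /GRing.scale /=; ring.
- move=> t; have D1 := @is_derive1_comp _ s (fun t => k * (t - (a + b) / 2)) _ _ _ (Ds _) (Dl t).
  have D2 := is_deriveZ (- kappa * k) D1.
  by apply: (is_derive_eq D2); rewrite /GRing.scale /=; ring.
- move=> t; rewrite in_itv/= => /andP[at_ tb].
  have h1 : k * (t - (a + b) / 2) <= x by rewrite -kb ler_pM2l// lerD2r.
  have h2 : - x <= k * (t - (a + b) / 2) by rewrite -ka ler_pM2l// lerD2r.
  have [h0|h0] := leP 0 (k * (t - (a + b) / 2)); first by apply: cpos; rewrite in_itv/= h0.
  have [_ <-] := par (k * (t - (a + b) / 2)).
  by apply: cpos; rewrite in_itv/= oppr_ge0 (ltW h0) lerNl.
- rewrite ka; have [-> ->] := par x; rewrite /load /k.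
  by field; rewrite ?cx ?lN.
- by rewrite kb /load /k; field; rewrite ?cx ?lN.
Qed.

(** The scale invariant eigenvalue in terms of the loads carried by the two
    directions, whose sum does not depend on the rectangle. *)
Lemma robin_lambda1_area (alpha0 x y : R) (r : rectangle R) :
  let A := xmax r - xmin r in let B := ymax r - ymin r in
  0 < alpha0 -> positive_phase c x -> positive_phase c y ->
  load c s x = alpha0 / 4 * (A / (A + B)) -> load c s y = alpha0 / 4 * (B / (A + B)) ->
  robin_lambda1 r (kappa * alpha0 / perimeter r) * area r =
    4 * (kappa * (load c s y * level c s x + load c s x * level c s y)).
Proof.
move=> A B a0 px py lx ly.
have A0 : 0 < A by rewrite subr_gt0 xmin_lt_xmax.
have B0 : 0 < B by rewrite subr_gt0 ymin_lt_ymax.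
have AN := lt0r_neq0 A0; have BN := lt0r_neq0 B0.
have ABN : A + B != 0 by rewrite lt0r_neq0// addr_gt0.
have mx := robin_mode_phase (xmin_lt_xmax r) px.
have my := robin_mode_phase (ymin_lt_ymax r) py.
have bx : kappa * (2 * load c s x / (xmax r - xmin r)) = kappa * alpha0 / perimeter r.
  by rewrite lx perimeterE -/A -/B; field; rewrite ?AN ?BN ?ABN.
have by_ : kappa * (2 * load c s y / (ymax r - ymin r)) = kappa * alpha0 / perimeter r.
  by rewrite ly perimeterE -/A -/B; field; rewrite ?AN ?BN ?ABN.
rewrite bx in mx; rewrite by_ in my.
rewrite (robin_lambda1E mx my) areaE -/A -/B.
have sq z : positive_phase c z -> z ^+ 2 = load c s z * level c s z.
  move=> pz; rewrite /load /level; field.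
  by rewrite (lt0r_neq0 (positive_phase_c pz)) (lt0r_neq0 (positive_phase_s osc pz)).
transitivity (4 * (kappa * (x ^+ 2 * (B / A) + y ^+ 2 * (A / B)))).
  by field; rewrite ?AN ?BN ?ABN.
rewrite !sq// lx ly; field.
by rewrite ?AN ?BN ?ABN.
Qed.

End robin_phase.

(** * Minimality of the square *)

(** The strict inequality comes from [level_mean_gt], applied to the loads of the
    two directions; their mean is the load of either direction of a square. *)
Lemma robin_lambda1_area_square (R : realType) (alpha : R) : alpha != 0 ->
  exists v, forall r : rectangle R,
    v <= robin_lambda1 r (alpha / perimeter r) * area r /\
    (robin_lambda1 r (alpha / perimeter r) * area r <= v <-> is_square r).
Proof.
move=> aN; have [kappa [c [s [osc aE phase]]]] := oscillator_of_sign aN.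
have a0 : 0 < `|alpha| by rewrite normr_gt0.
have [w pw lw] : exists2 w, positive_phase c w & load c s w = `|alpha| / 8.
  by apply: phase; rewrite divr_gt0.
exists (4 * (kappa * (2 * load c s w * level c s w))) => r0.
set V := _ * area r0.
have A0 : 0 < xmax r0 - xmin r0 by rewrite subr_gt0 xmin_lt_xmax.
have B0 : 0 < ymax r0 - ymin r0 by rewrite subr_gt0 ymin_lt_ymax.
have AB0 := addr_gt0 A0 B0.
have [x px lx] : exists2 x, positive_phase c x & load c s x = `|alpha| / 4 *
    ((xmax r0 - xmin r0) / (xmax r0 - xmin r0 + (ymax r0 - ymin r0))).
  by apply: phase; rewrite mulr_gt0 ?divr_gt0.
have [y py ly] : exists2 y, positive_phase c y & load c s y = `|alpha| / 4 *
    ((ymax r0 - ymin r0) / (xmax r0 - xmin r0 + (ymax r0 - ymin r0))).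
  by apply: phase; rewrite mulr_gt0 ?divr_gt0.
have VE : V = 4 * (kappa * (load c s y * level c s x + load c s x * level c s y)).
  by rewrite -(robin_lambda1_area osc a0 px py lx ly) -aE.
have mean : load c s x + load c s y = 2 * load c s w.
  by rewrite lx ly lw; field; rewrite lt0r_neq0.
set v := 4 * _.
suff [sqE nsq_lt] : (is_square r0 -> V = v) /\ (~ is_square r0 -> v < V).
  have [sq|nsq] := pselect (is_square r0); first by rewrite sqE.
  by split; [exact/ltW/nsq_lt|split=> // ; rewrite leNgt nsq_lt].
split=> [sq|nsq].
  have level_eq z : positive_phase c z -> load c s z = load c s w ->
      kappa * level c s z = kappa * level c s w.
    move=> pz lz; apply/eqP; rewrite eq_le.
    have := level_tangent osc pz pw; have := level_tangent osc pw pz.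
    by rewrite lz !lerD2r => -> ->.
  have lxy : load c s x = load c s y by rewrite lx ly sq.
  have lxw : load c s x = load c s w by lra.
  have lyw : load c s y = load c s w by lra.
  have ex := level_eq x px lxw; have ey := level_eq y py lyw.
  rewrite VE /v lxw lyw.
  transitivity (4 * (load c s w * (kappa * level c s x) + load c s w * (kappa * level c s y))).
    by ring.
  by rewrite ex ey; ring.
rewrite VE /v ltr_pM2l//; apply: level_mean_gt => //.
apply/eqP => lxy; apply: nsq; rewrite /is_square.
move: lxy; rewrite lx ly => /(mulfI (lt0r_neq0 (divr_gt0 a0 (ltr0Sn R 3)))).
by apply: mulIf; rewrite invr_eq0 lt0r_neq0.
Qed.

Theorem theorem3p2 (R : realType) (alpha : R) (halpha : alpha != 0)
    (r : rectangle R) :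
  (forall r' : rectangle R,
     robin_lambda1 r (alpha / perimeter r) * area r
       <= robin_lambda1 r' (alpha / perimeter r') * area r')
  <-> is_square r.
Proof.
have [v Hv] := robin_lambda1_area_square halpha.
split=> [rmin|/(Hv r).2 rv r'].
  pose q : rectangle R := Rectangle 0 (@ltr01 R) (@ltr01 R).
  have qv := (Hv q).2.2 erefl.
  exact/(Hv r).2/(le_trans (rmin q) qv).
exact: le_trans rv (Hv r').1.
Qed.
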